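(* Let $T$ be a complete theory with monster model $\mathcal{U}$ and $M\prec\mathcal{U}$ small. Suppose $\mu,\nu\in\mathfrak{M}_x(\mathcal{U})$ are fim over $M$, and fix $r\in[0,1]$. Then $\lambda=r\mu+(1-r)\nu$ is fim over $M$.
   Context: Global Keisler measures in $x$: finitely additive probability measures on $\mathcal{L}_{\mathcal{U}}$-formulas in $x$. $\mu$ invariant over $A$: $\mu(\phi(x,b))=\mu(\phi(x,b'))$ whenever $b\equiv_A b'$; $F^\phi_{\mu,A}(q)=\mu(\phi(x,b))$ for $b\models q\in S_y(A)$; definable (Borel definable) over $A$: $A$-invariant with all $F^\phi_{\mu,A}$ continuous (Borel). Morley product for Borel definable $\mu$: $(\mu\otimes\nu)(\phi(x,y))=\int_{S_y(B)}F^\phi_{\mu,B}\,d(\nu|_B)$; powers $\mu^{(1)}=\mu_{x_1}$, $\mu^{(n+1)}=\mu_{x_{n+1}}\otimes\mu^{(n)}_{x_1\dots x_n}$. $\operatorname{Av}(\bar a)=\frac1n\sum_i\delta_{a_i}$. $\mu$ is fim over $M$ if for every $\mathcal{L}$-formula $\phi(x,y)$ there are consistent $\mathcal{L}_M$-formulas $\theta_n(x_1,\dots,x_n)$ such that (i) for each $\epsilon>0$ there is $n(\epsilon)$ with: $n\ge n(\epsilon)$ and $\bar a\models\theta_n$ imply $|\mu(\phi(x,b))-\operatorname{Av}(\bar a)(\phi(x,b))|<\epsilon$ for all $b\in\mathcal{U}^y$; (ii) $\lim_n\mu^{(n)}(\theta_n)=1$. *)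

(* Defs.v *)
From HB Require Import structures.
From mathcomp Require Import all_boot all_order all_algebra.
From mathcomp Require Import all_classical all_reals all_analysis.

Set Implicit Arguments.
Unset Strict Implicit.
Unset Printing Implicit Defensive.

Import Order.TTheory GRing.Theory Num.Theory.
Import numFieldNormedType.Exports.

Local Open Scope classical_set_scope.
Local Open Scope ring_scope.

(* First-order logic, one-sorted, with equality.                              *)

Record language := Language {
  fsym : Type;
  rsym : Type;
  farity : fsym -> nat;
  rarity : rsym -> nat
}.

Inductive term (L : language) (V : Type) : Type :=
| TVar of V
| TApp (f : fsym L) of 'I_(farity f) -> term L V.

(* [formula L V] has its free variables indexed by [V]; a quantifier binds    *)
(* the extra variable [None] of [option V].                                   *)
Inductive formula (L : language) (V : Type) : Type :=
| FFalse
| FEq of term L V & term L V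
| FRel (s : rsym L) of 'I_(rarity s) -> term L V
| FImp of formula L V & formula L V
| FAll of formula L (option V).

Arguments FFalse {L V}.

HB.instance Definition _ (L : language) (V : Type) := gen_eqMixin (formula L V).
HB.instance Definition _ (L : language) (V : Type) :=
  gen_choiceMixin (formula L V).
HB.instance Definition _ (L : language) (V : Type) :=
  isPointed.Build (formula L V) FFalse.

Definition FNot (L : language) (V : Type) (p : formula L V) := FImp p FFalse.
Definition FTrue (L : language) (V : Type) : formula L V := FNot FFalse.
Definition FOr (L : language) (V : Type) (p q : formula L V) :=
  FImp (FNot p) q.
Definition FAnd (L : language) (V : Type) (p q : formula L V) :=
  FNot (FImp p (FNot q)).

Arguments FTrue {L V}.

Fixpoint tvars (L : language) (V : Type) (t : term L V) : set V :=
  match t with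
  | TVar v => [set v]
  | TApp _ a => \bigcup_i tvars (a i)
  end.

Fixpoint fvars (L : language) (V : Type) (p : formula L V) : set V :=
  match p with
  | FFalse => set0
  | FEq s t => tvars s `|` tvars t
  | FRel _ a => \bigcup_i tvars (a i)
  | FImp p q => fvars p `|` fvars q
  | FAll p => Some @^-1` fvars p
  end.

Fixpoint trename (L : language) (V W : Type) (h : V -> W) (t : term L V) :
    term L W :=
  match t with
  | TVar v => TVar L (h v)
  | TApp f a => TApp (fun i => trename h (a i))
  end.

Fixpoint rename (L : language) (V W : Type) (h : V -> W) (p : formula L V) :
    formula L W :=
  match p with
  | FFalse => FFalse
  | FEq s t => FEq (trename h s) (trename h t)
  | FRel s a => FRel (fun i => trename h (a i))
  | FImp p q => FImp (rename h p) (rename h q)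
  | FAll p => FAll (rename (omap h) p)
  end.

Record structure (L : language) := Structure {
  dom :> Type;
  fint : forall f : fsym L, ('I_(farity f) -> dom) -> dom;
  rint : forall s : rsym L, ('I_(rarity s) -> dom) -> Prop;
  dom_inhabited : inhabited dom
}.

Fixpoint eval (L : language) (U : structure L) (V : Type) (e : V -> U)
    (t : term L V) : U :=
  match t with
  | TVar v => e v
  | TApp f a => fint (fun i => eval e (a i))
  end.

Fixpoint sat (L : language) (U : structure L) (V : Type) (e : V -> U)
    (p : formula L V) : Prop :=
  match p with
  | FFalse => False
  | FEq s t => eval e s = eval e t
  | FRel s a => rint (fun i => eval e (a i))
  | FImp p q => sat e p -> sat e q
  | FAll p => forall u : U, sat (oapp e u) p
  end.

Definition sentence (L : language) := formula L void.

Definition truth (L : language) (U : structure L) (s : sentence L) : Prop :=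
  sat (of_void U) s.

Definition models (L : language) (U : structure L) (T : set (sentence L)) : Prop :=
  forall s, T s -> truth U s.

Definition entails (L : language) (T : set (sentence L)) (s : sentence L) : Prop :=
  forall N : structure L, models N T -> truth N s.

Definition complete_theory (L : language) (T : set (sentence L)) : Prop :=
  (exists N : structure L, models N T) /\
  forall s, entails T s \/ entails T (FNot s).

Definition elementary_substructure (L : language) (U : structure L)
    (M : set U) : Prop :=
  exists (N : structure L) (j : N -> U), range j = M /\
    forall (V : Type) (p : formula L V) (e : V -> N),
      sat e p <-> sat (j \o e) p.

(* Formulas with parameters: an L_U-formula in the variables x = (x_i)_{i:X}  *)
(* is a [formula L (X + U)], where [inr u] stands for the parameter u.  The   *)
(* L_A-formulas are those satisfying [formula_over A]; the L-formulas are     *)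
(* those satisfying [formula_over set0].                                      *)

Section WithConstants.
Variables (L : language) (U : structure L).

Definition params (X : Type) (p : formula L (X + U)) : set U :=
  [set u | fvars p (inr u)].

Definition formula_over (A : set U) (X : Type) (p : formula L (X + U)) : Prop :=
  params p `<=` A.

Definition holds (X : Type) (a : X -> U) (p : formula L (X + U)) : Prop :=
  sat (fun z => match z with inl x => a x | inr u => u end) p.

Definition consistent (X : Type) (p : formula L (X + U)) : Prop :=
  exists a : X -> U, holds a p.

(* phi(x, y) |-> phi(x, b) *)
Definition inst (X Y : Type) (p : formula L ((X + Y) + U)) (b : Y -> U) :
    formula L (X + U) :=
  rename (fun z => match z with
                   | inl (inl x) => inl x
                   | inl (inr y) => inr (b y)
                   | inr u => inr u
                   end) p.

Definition rename_vars (X Y : Type) (h : X -> Y) (p : formula L (X + U)) :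
    formula L (Y + U) :=
  rename (fun z => match z with inl x => inl (h x) | inr u => inr u end) p.

(* Closure under conjunction follows from [ctype_fsat] and [ctype_compl].     *)
Record is_ctype (A : set U) (Y : Type) (q : set (formula L (Y + U))) : Prop :=
{
  ctype_over : forall p, q p -> formula_over A p;
  ctype_fsat : forall s : seq (formula L (Y + U)),
    (forall p, p \in s -> q p) ->
    exists b : Y -> U, forall p, p \in s -> holds b p;
  ctype_compl : forall p, formula_over A p -> q p \/ q (FNot p)
}.

(* S_y(A) *)
Definition ctype (A : set U) (Y : Type) :=
  {q : set (formula L (Y + U)) | is_ctype A q}.

Definition realizes (A : set U) (Y : Type) (b : Y -> U) (q : ctype A Y) : Prop :=
  forall p, sval q p -> holds b p.

Definition ctype_clopen (A : set U) (Y : Type) (p : formula L (Y + U)) :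
    set (ctype A Y) :=
  [set q | sval q p].

Lemma is_ctype_tp (A : set U) (Y : Type) (b : Y -> U) :
  is_ctype A [set p : formula L (Y + U) | formula_over A p /\ holds b p].
Proof.
split=> [p []//|s sq|p Ap]; first by exists b => p /sq[].
have [bp|nbp] := pselect (holds b p); [by left|right].
by split=> // u [/Ap|].
Qed.

(* tp(b/A) *)
Definition tp (A : set U) (Y : Type) (b : Y -> U) : ctype A Y :=
  exist _ _ (is_ctype_tp A b).

Definition ctype_point (A : set U) (Y : Type) : ctype A Y :=
  tp A (fun=> sval (cid (let: inhabits u := dom_inhabited U in
                         ex_intro xpredT u isT))).

HB.instance Definition _ (A : set U) (Y : Type) := gen_eqMixin (ctype A Y).
HB.instance Definition _ (A : set U) (Y : Type) := gen_choiceMixin (ctype A Y).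
HB.instance Definition _ (A : set U) (Y : Type) :=
  isPointed.Build (ctype A Y) (ctype_point A Y).
HB.instance Definition _ (A : set U) (Y : Type) :=
  @isSubBaseTopological.Build (ctype A Y) (formula L (Y + U))
    [set p | formula_over A p] (@ctype_clopen A Y).

Definition automorphism (g : U -> U) : Prop :=
  [/\ bijective g,
      forall (f : fsym L) (a : 'I_(farity f) -> U), g (fint a) = fint (g \o a) &
      forall (s : rsym L) (a : 'I_(rarity s) -> U), rint a <-> rint (g \o a)].

Definition partial_elementary (A : set U) (f : U -> U) : Prop :=
  forall (V : Type) (p : formula L V) (e : V -> U),
    (forall v, A (e v)) -> (sat e p <-> sat (f \o e) p).

End WithConstants.

(* The type [K] plays the role of the cardinal kappa.                         *)
Definition smaller (S : Type) (A : set S) (K : Type) : Prop :=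
  (A #<= [set: K])%card /\ ~ ([set: K] #<= A)%card.

Definition saturated (L : language) (U : structure L) (K : Type) : Prop :=
  forall A : set U, smaller A K ->
  forall (Y : finType) (q : ctype A Y), exists b : Y -> U, realizes b q.

Definition strongly_homogeneous (L : language) (U : structure L) (K : Type) : Prop :=
  forall A : set U, smaller A K ->
  forall f : U -> U, partial_elementary A f ->
  exists2 g : U -> U, automorphism g & forall u, A u -> g u = f u.

(* kappa > |L| + aleph_0; small sets are those of cardinality < kappa *)
Definition monster (L : language) (U : structure L) (K : Type) : Prop :=
  [/\ [/\ smaller [set: nat] K, smaller [set: fsym L] K &
          smaller [set: rsym L] K],
      saturated U K & strongly_homogeneous U K].

Section KeislerMeasures.
Variables (R : realType) (L : language) (U : structure L).

Record keisler_measure (X : Type) (mu : formula L (X + U) -> R) : Prop := {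
  keisler_ge0 : forall p, 0 <= mu p;
  keisler_true : mu FTrue = 1;
  keisler_equiv : forall p q,
    (forall a : X -> U, holds a p <-> holds a q) -> mu p = mu q;
  keisler_add : forall p q,
    ~ consistent (FAnd p q) -> mu (FOr p q) = mu p + mu q
}.

(* F^phi_{mu,B}; the value at q does not depend on the realization of q when  *)
(* phi is over B and mu is invariant over B, and is 0 by convention when q    *)
(* is not realized.                                                           *)
Definition Fmap (X Y : Type) (mu : formula L (X + U) -> R) (B : set U)
    (p : formula L ((X + Y) + U)) (q : ctype B Y) : R :=
  xget 0 [set r | exists2 b : Y -> U, realizes b q & r = mu (inst p b)].

Definition borel_ctype (B : set U) (Y : Type) :=
  g_sigma_algebraType (@open (ctype B Y)).

(* [P] is the regular Borel probability measure on S_y(B) identified with the *)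
(* restriction of [nu] to the L_B-formulas.  On a compact space, outer        *)
(* regularity on Borel sets gives inner regularity by passing to complements. *)
Record is_restriction (B : set U) (Y : Type) (nu : formula L (Y + U) -> R)
    (P : probability (borel_ctype B Y) R) : Prop := {
  restriction_clopen : forall p, formula_over B p ->
    P (@ctype_clopen L U B Y p) = (nu p)%:E;
  restriction_regular : forall E : set (borel_ctype B Y), measurable E ->
    P E = ereal_inf [set P O | O in [set O : set (ctype B Y) |
                                       open O /\ E `<=` O]]
}.

(* mu \otimes nu for mu Borel definable over A; to evaluate it at phi, take   *)
(* for B the set A together with the parameters of phi.  [xget] only extracts *)
(* the value of the integral from the existence and uniqueness of P.          *)
Definition morley (A : set U) (X Y : Type)
    (mu : formula L (X + U) -> R) (nu : formula L (Y + U) -> R)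
    (p : formula L ((X + Y) + U)) : R :=
  let B := A `|` params p in
  xget 0 [set r | exists2 P : probability (borel_ctype B Y) R,
                    is_restriction nu P &
                    r%:E = (\int[P]_q (Fmap mu p q)%:E)%E].

Definition split_last (n : nat) (X : Type) (z : 'I_n.+1 * X) : X + 'I_n * X :=
  if unlift ord_max z.1 is Some i then inr (i, z.2) else inl z.2.

(* [morley_power A mu n] is mu^(n+1), in the variables x_0, ..., x_n, where   *)
(* [(i, j) : 'I_n.+1 * X] indexes the j-th coordinate of x_i.                 *)
Fixpoint morley_power (A : set U) (X : Type) (mu : formula L (X + U) -> R)
    (n : nat) : formula L (('I_n.+1 * X) + U) -> R :=
  match n with
  | 0 => fun p => mu (rename_vars snd p)
  | n'.+1 => fun p =>
      morley A mu (@morley_power A X mu n') (rename_vars (@split_last n'.+1 X) p)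
  end.

Arguments morley_power A {X} mu n p.

Definition Av (n : nat) (X : Type) (a : 'I_n * X -> U)
    (p : formula L (X + U)) : R :=
  n%:R^-1 * \sum_(i < n) (`[< holds (fun j => a (i, j)) p >])%:R.

(* The conditions on theta already force mu to be definable over M, so the    *)
(* Morley powers below are meaningful.                                        *)
Definition fim (M : set U) (X : finType) (mu : formula L (X + U) -> R) : Prop :=
  forall (Y : finType) (phi : formula L ((X + Y) + U)),
  formula_over set0 phi ->
  exists theta : forall n, formula L (('I_n * X) + U),
    [/\ forall n, formula_over M (theta n) /\ consistent (theta n),
        forall eps : R, 0 < eps -> exists N : nat,
          forall n (a : 'I_n * X -> U), (N <= n)%N -> holds a (theta n) ->
          forall b : Y -> U, `|mu (inst phi b) - Av a (inst phi b)| < eps &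
        morley_power M mu n (theta n.+1) @[n --> \oo] --> (1 : R)].

End KeislerMeasures.

Arguments morley_power {R L U} A {X} mu n p.

(* Main.v *)
Require Import Defs.
From HB Require Import structures.
From mathcomp Require Import all_boot all_order all_algebra.
From mathcomp Require Import all_classical all_reals all_analysis.
From mathcomp Require Import finmap ring lra measurable_realfun.

Set Implicit Arguments.
Unset Strict Implicit.
Unset Printing Implicit Defensive.

Import Order.TTheory GRing.Theory Num.Theory.
Import numFieldNormedType.Exports.

Local Open Scope classical_set_scope.
Local Open Scope ring_scope.

(* Write lambda^(n) as the sum over words s in {mu, nu}^n of the Bernoulli(r)
   weight of s times the Morley product of the letters of s. Restricted to the
   positions carrying mu, such a product is a Morley power of mu, and likewise
   for nu, whatever the order of the letters; so no commutation of mu and nu is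
   needed. If s is typical (its number k of mu's satisfies k/n ~ r), the
   conjunction of the formula theta_k of mu at the mu-positions and of the
   formula theta_(n-k) of nu at the other positions has measure close to 1, and
   its solutions have an average close to lambda. The formula for lambda is the
   disjunction over typical words, which carry almost all of the weight by
   Chebyshev's inequality.

   The Morley product is computed by finitely additive means: a measure which is
   fim over M is uniformly approximated by averages of points of M, so
   b |-> mu(phi(x, b)) is a uniform limit of step functions. The only measure
   theory needed is that a Keisler measure extends to a regular Borel probability
   on the type space. *)

(** * Syntax *)

Section Syntax.
Variables (L : language) (U : structure L).

Lemma eval_trename (V W : Type) (h : V -> W) (e : W -> U) (t : term L V) :
  Defs.eval e (trename h t) = Defs.eval (e \o h) t.
Proof. by elim: t => [v|f a IH] //=; congr fint; apply/funext => i; apply: IH. Qed.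

Lemma sat_rename (V W : Type) (h : V -> W) (e : W -> U) (p : formula L V) :
  sat e (rename h p) <-> sat (e \o h) p.
Proof.
elim: p W h e => [V'|V' s t|V' s a|V' p IHp q IHq|V' p IHp] W h e //=.
- by rewrite !eval_trename.
- have -> // : (fun i => Defs.eval e (trename h (a i))) = fun i => Defs.eval (e \o h) (a i).
  by apply/funext => i; rewrite eval_trename.
- by rewrite IHp IHq.
- have oE u : oapp e u \o omap h = oapp (e \o h) u by apply/funext => -[].
  by split=> + u => /(_ u); rewrite IHp oE.
Qed.

Lemma eq_eval (V : Type) (e e' : V -> U) (t : term L V) :
  (forall v, tvars t v -> e v = e' v) -> Defs.eval e t = Defs.eval e' t.
Proof.
elim: t => [v|f a IH] /= ee'; first exact: ee'.
by congr fint; apply/funext => i; apply: IH => v av; apply: ee'; exists i.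
Qed.

Lemma eq_sat (V : Type) (e e' : V -> U) (p : formula L V) :
  (forall v, fvars p v -> e v = e' v) -> sat e p <-> sat e' p.
Proof.
elim: p e e' => [V'|V' s t|V' s a|V' p IHp q IHq|V' p IHp] e e' //= ee'.
- by rewrite (@eq_eval _ e e') ?(@eq_eval _ e e' t) // => v ?; apply: ee'; [right|left].
- have -> // : (fun i => Defs.eval e (a i)) = (fun i => Defs.eval e' (a i)).
  by apply/funext => i; apply: eq_eval => v av; apply: ee'; exists i.
- by rewrite (IHp e e') ?(IHq e e') // => v ?; apply: ee'; [right|left].
- by split=> + u => /(_ u); rewrite (IHp (oapp e u) (oapp e' u)) // => -[v /ee'|].
Qed.

Lemma tvars_trename (V W : Type) (h : V -> W) (t : term L V) :
  tvars (trename h t) = h @` tvars t.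
Proof.
elim: t => [v|f a IH] /=; first by rewrite image_set1.
by rewrite image_bigcup; apply: eq_bigcupr => i _; apply: IH.
Qed.

Lemma fvars_rename (V W : Type) (h : V -> W) (p : formula L V) :
  fvars (rename h p) = h @` fvars p.
Proof.
elim: p W h => [V'|V' s t|V' s a|V' p IHp q IHq|V' p IHp] W h /=.
- by rewrite image_set0.
- by rewrite !tvars_trename image_setU.
- by rewrite image_bigcup; apply: eq_bigcupr => i _; rewrite tvars_trename.
- by rewrite IHp IHq image_setU.
- rewrite IHp; apply/seteqP; split=> [w [[v|//] pv [<-]]|_ [v pv <-]]; first by exists v.
  by exists (Some v).
Qed.

Lemma finite_tvars (V : Type) (t : term L V) : finite_set (tvars t).
Proof. by elim: t => [v|f a IH] /=; [exact: finite_set1|apply: bigcup_finite]. Qed.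

Lemma finite_fvars (V : Type) (p : formula L V) : finite_set (fvars p).
Proof.
elim: p => [V'|V' s t|V' s a|V' p IHp q IHq|V' p IHp] //=.
- by rewrite finite_setU; split; apply: finite_tvars.
- by apply: bigcup_finite => // i _; apply: finite_tvars.
- by rewrite finite_setU.
- by apply: finite_preimage IHp => x y _ _ [].
Qed.

Lemma finite_params (X : Type) (p : formula L (X + U)) : finite_set (params p).
Proof. by apply: finite_preimage (finite_fvars p) => x y _ _ []. Qed.

Lemma sat_FNot (V : Type) (e : V -> U) p : sat e (FNot p) <-> ~ sat e p.
Proof. by []. Qed.

Lemma sat_FOr (V : Type) (e : V -> U) p q :
  sat e (FOr p q) <-> sat e p \/ sat e q.
Proof.
split=> [pq|]; last by case=> [ep np|eq _ //]; case: (np ep).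
by have [ep|np] := pselect (sat e p); [left|right; apply: pq].
Qed.

Lemma sat_FAnd (V : Type) (e : V -> U) p q :
  sat e (FAnd p q) <-> sat e p /\ sat e q.
Proof.
split=> [pq|]; last by case=> ep eq; apply.
by split; apply: contrapT => ne; apply: pq => // ?; exfalso; apply: ne.
Qed.

Lemma holdsN (X : Type) (a : X -> U) p : holds a (FNot p) <-> ~ holds a p.
Proof. exact: sat_FNot. Qed.

Lemma holdsU (X : Type) (a : X -> U) p q :
  holds a (FOr p q) <-> holds a p \/ holds a q.
Proof. exact: sat_FOr. Qed.

Lemma holdsI (X : Type) (a : X -> U) p q :
  holds a (FAnd p q) <-> holds a p /\ holds a q.
Proof. exact: sat_FAnd. Qed.

Lemma holdsT (X : Type) (a : X -> U) : holds a FTrue.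
Proof. by []. Qed.

Definition pairing (X Y : Type) (a : X -> U) (b : Y -> U) (z : X + Y) : U :=
  match z with inl x => a x | inr y => b y end.

Lemma holds_inst (X Y : Type) (p : formula L ((X + Y) + U)) a b :
  holds a (inst p b) <-> holds (pairing a b) p.
Proof.
rewrite /holds /inst sat_rename.
set e1 := (X in sat X _); set e2 := (X in _ <-> sat X _).
suff -> : e1 = e2 by [].
by apply/funext => -[[]|].
Qed.

Lemma holds_rename_vars (X Y : Type) (h : X -> Y) (p : formula L (X + U)) a :
  holds a (rename_vars h p) <-> holds (a \o h) p.
Proof.
rewrite /holds /rename_vars sat_rename.
set e1 := (X in sat X _); set e2 := (X in _ <-> sat X _).
suff -> : e1 = e2 by [].
by apply/funext => -[].
Qed.

(** Substituting on the left turns a point [a] of [M] into the instance [phi(a, y)], the building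
    block of step functions on the type space in [y]. *)
Definition inst_left (X Y : Type) (p : formula L ((X + Y) + U)) (a : X -> U) :
    formula L (Y + U) :=
  inst (rename_vars (fun z => match z with inl x => inr x | inr y => inl y end) p) a.

Lemma holds_inst_left (X Y : Type) (p : formula L ((X + Y) + U)) a b :
  holds b (inst_left p a) <-> holds (pairing a b) p.
Proof.
rewrite /inst_left holds_inst holds_rename_vars.
set e1 := (X in holds X _); set e2 := (X in _ <-> holds X _).
suff -> : e1 = e2 by [].
by apply/funext => -[].
Qed.

Lemma params_rename_vars (X Y : Type) (h : X -> Y) (p : formula L (X + U)) :
  params (rename_vars h p) = params p.
Proof.
rewrite /params /rename_vars fvars_rename; apply/seteqP; split=> u /=.
  by case=> -[//|v] pv [<-].
by move=> pu; exists (inr u).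
Qed.

Lemma params_inst_sub (X Y : Type) (p : formula L ((X + Y) + U)) (b : Y -> U) :
  params (inst p b) `<=` range b `|` params p.
Proof.
rewrite /params /inst fvars_rename => u [[[x//|y]|v]] pv [<-]; last by right.
by left; exists y.
Qed.

Lemma formula_over_inst_left (A : set U) (X Y : Type)
    (p : formula L ((X + Y) + U)) (a : X -> U) :
  (forall x, A (a x)) -> formula_over (A `|` params p) (inst_left p a).
Proof.
move=> Aa u /params_inst_sub []; last by rewrite params_rename_vars; right.
by case=> x _ <-; left.
Qed.

Lemma formula_overT (A : set U) (X : Type) : formula_over A (@FTrue L (X + U)).
Proof. by move=> u []. Qed.

Lemma formula_overN (A : set U) (X : Type) (p : formula L (X + U)) :
  formula_over A p -> formula_over A (FNot p).
Proof. by move=> Ap u [/Ap|]. Qed.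

Lemma formula_overU (A : set U) (X : Type) (p q : formula L (X + U)) :
  formula_over A p -> formula_over A q -> formula_over A (FOr p q).
Proof. by move=> Ap Aq u [[/Ap|]|/Aq]. Qed.

Lemma formula_overI (A : set U) (X : Type) (p q : formula L (X + U)) :
  formula_over A p -> formula_over A q -> formula_over A (FAnd p q).
Proof. by move=> Ap Aq; apply: formula_overN => u [/Ap|[/Aq|]]. Qed.

Lemma formula_over_rename_vars (A : set U) (X Y : Type) (h : X -> Y)
    (p : formula L (X + U)) :
  formula_over A p -> formula_over A (rename_vars h p).
Proof. by rewrite /formula_over params_rename_vars. Qed.

(** The fim condition only speaks of formulas without parameters. The finitely many parameters of
    [p] become values [c] of extra variables, so the condition can be applied to [p'] at
    [(b, c)]. *)
Lemma parameter_free (X Y : Type) (p : formula L ((X + Y) + U)) :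
  exists (m : nat) (c : 'I_m -> U) (p' : formula L ((X + (Y + 'I_m)) + U)),
    formula_over set0 p' /\
    forall a b, holds (pairing a (pairing b c)) p' <-> holds (pairing a b) p.
Proof.
have [s sE] := (@finite_seqP {classic U} _).1 (finite_params p).
have [u0] := dom_inhabited U.
(* The successor adds a last index, sent to the default [u0], so that [h] below is total even when
   [p] has no parameters. *)
pose c (i : 'I_(size s).+1) : U := @nth {classic U} u0 s i.
have [h hE] : exists h : U -> 'I_(size s).+1, forall u, params p u -> c (h u) = u.
  exists (fun u => inord (@index {classic U} u s)) => u pu.
  have us : (u : {classic U}) \in s.
    by rewrite -[is_true _]/([set` s] (u : {classic U})) -sE.
  rewrite /c inordK ?ltnS ?index_size; [exact: (@nth_index {classic U})|by []].
exists _, c, (rename (fun z => match z with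
  | inl (inl x) => inl (inl x) | inl (inr y) => inl (inr (inl y))
  | inr u => inl (inr (inr (h u))) end) p); split.
  by move=> u; rewrite /params fvars_rename => -[[[]|]].
move=> a b; rewrite /holds sat_rename; apply: eq_sat => -[[]|u]//= pu.
exact: hE.
Qed.

End Syntax.

(** * Existential quantification over tuples, and witnesses in elementary substructures *)

(** Variables are bound one at a time, the last index becoming [None]. The same [q] works in every
    structure [N], so its truth can be compared between [U] and an elementary substructure. *)
Lemma exists_quantifier_ord (L : language) (n : nat) (W : Type)
    (p : formula L ('I_n + W)) :
  exists q : formula L W, forall (N : structure L) (e : W -> N),
    sat e q <-> exists a : 'I_n -> N,
      sat (fun z => match z with inl i => a i | inr w => e w end) p.
Proof.
elim: n => [|n IH] in p *.
  have of_ord0 T : 'I_0 -> T by case.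
  exists (rename (fun z => match z with inl i => of_ord0 W i | inr w => w end) p) => N e.
  rewrite sat_rename; set e1 := _ \o _.
  have e1E a : e1 = fun z => match z with inl i => a i | inr w => e w end.
    by apply/funext => -[[]|].
  split=> [e1p|[a]]; last by rewrite -(e1E a).
  by exists (of_ord0 N); rewrite -e1E.
pose h (z : 'I_n.+1 + W) : option ('I_n + W) := match z with
  inl i => if unlift ord_max i is Some j then Some (inl j) else None
  | inr w => Some (inr w) end.
have [q qE] := IH (FNot (FAll (FNot (rename h p)))).
exists q => N e; rewrite qE; split.
  move=> [a] /= au; set e1 := fun z => _ in au.
  have [u] : exists u, sat (oapp e1 u) (rename h p).
    by apply: contrapT => nu; apply: au => u pu; apply: nu; exists u.
  rewrite sat_rename => {}au.
  exists (fun i => if unlift ord_max i is Some j then a j else u).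
  by apply/(eq_sat _).1: au => -[i|w] _ //=; case: unliftP.
move=> [a ap]; exists (a \o lift ord_max) => /= /(_ (a ord_max)); apply.
rewrite sat_rename; apply/(eq_sat _).1: ap => -[i|w] _ //=.
by case: unliftP => [j ->|->].
Qed.

Lemma exists_quantifier (L : language) (F : finType) (W : Type)
    (p : formula L (F + W)) :
  exists q : formula L W, forall (N : structure L) (e : W -> N),
    sat e q <-> exists a : F -> N,
      sat (fun z => match z with inl i => a i | inr w => e w end) p.
Proof.
have [q qE] := exists_quantifier_ord (rename (fun z => match z with
  inl x => inl (enum_rank x) | inr w => inr w end) p).
exists q => N e; rewrite qE; split=> -[a].
  rewrite sat_rename => ap; exists (a \o enum_rank).
  by apply/(eq_sat _).1: ap => -[].
move=> ap; exists (a \o enum_val); rewrite sat_rename.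
by apply/(eq_sat _).1: ap => -[x|w] _ //=; rewrite enum_rankK.
Qed.

(** Parameters are pulled back along a section [g] of [j] over [M]. The existence of a solution is
    then one formula with values in [N]; it is true in [U], hence in [N]. *)
Lemma elementary_witness (L : language) (U : structure L) (M : set U)
    (F : finType) (p : formula L (F + U)) :
  elementary_substructure M -> formula_over M p -> consistent p ->
  exists2 a : F -> U, (forall x, M (a x)) & holds a p.
Proof.
move=> [N [j [jM jE]]] Mp [a ap].
have [n0] := dom_inhabited N.
have [g gE] : exists g : U -> N, forall u, M u -> j (g u) = u.
  have /choice[g gE] : forall u, exists n : N, M u -> j n = u.
    move=> u; have [|nMu] := pselect (M u); last by exists n0.
    by rewrite -jM => -[n _ <-]; exists n.
  by exists g.
pose p' := rename (fun z => match z with inl x => inl x | inr u => inr (g u) end) p.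
have [q qE] := exists_quantifier p'.
have : sat (j \o id) q.
  apply/qE; exists a; rewrite sat_rename; apply/(eq_sat _).1: ap => -[x|u]//= pu.
  by rewrite gE//; apply: Mp.
rewrite -jE qE => -[b]; rewrite jE sat_rename => bp.
exists (j \o b); first by move=> x; rewrite -jM; exists (b x).
apply/(eq_sat _).1: bp => -[x|u]//= pu.
by rewrite gE//; apply: Mp.
Qed.

(** * Type spaces *)

Section TypeSpace.
Variables (L : language) (U : structure L) (A : set U) (Y : Type).
Local Notation form := (formula L (Y + U)).
Local Notation "⟦ p ⟧" := (@ctype_clopen L U A Y p) (format "⟦ p ⟧").

Lemma ctype_deduction (q : ctype A Y) (s : seq form) (r : form) :
  formula_over A r -> (forall p, p \in s -> sval q p) ->
  (forall b : Y -> U, (forall p, p \in s -> holds b p) -> holds b r) -> sval q r.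
Proof.
move=> Ar sq sr; have [//|qNr] := ctype_compl (svalP q) Ar.
have [|b bs] := ctype_fsat (svalP q) (s := FNot r :: s).
  by move=> p; rewrite inE => /predU1P[->//|/sq].
have /holdsN[] := bs _ (mem_head _ _).
by apply: sr => p ps; apply: bs; rewrite inE ps orbT.
Qed.

Lemma clopen_sub (p q : form) : formula_over A p -> formula_over A q ->
  ⟦p⟧ `<=` ⟦q⟧ <-> forall b : Y -> U, holds b p -> holds b q.
Proof.
move=> Ap Aq; split=> [pq b bp|pq t tp].
  by have /(_ _)[] := pq (tp A b).
apply: (@ctype_deduction t [:: p] q) => // [r|b].
  by rewrite inE => /eqP->.
by move=> /(_ p (mem_head _ _)) /pq.
Qed.

Lemma clopenT : ⟦FTrue⟧ = setT.
Proof.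
apply/seteqP; split=> // t _; apply: (@ctype_deduction t [::]) => // [|b _].
  exact: formula_overT.
exact: holdsT.
Qed.

Lemma clopenN p : formula_over A p -> ⟦FNot p⟧ = ~` ⟦p⟧.
Proof.
move=> Ap; apply/seteqP; split=> [t tNp tp|t]; last first.
  by have [|//] := ctype_compl (svalP t) Ap.
have [|b bs] := ctype_fsat (svalP t) (s := [:: p; FNot p]).
  by move=> r; rewrite !inE => /orP[] /eqP->.
have /holdsN[] : holds b (FNot p) by apply: bs; rewrite !inE eqxx orbT.
by apply: bs; rewrite !inE eqxx.
Qed.

Lemma clopenU p q : formula_over A p -> formula_over A q ->
  ⟦FOr p q⟧ = ⟦p⟧ `|` ⟦q⟧.
Proof.
move=> Ap Aq; have Apq := formula_overU Ap Aq.
apply/seteqP; split=> [t tpq|t [tp|tq]]; last first.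
- by apply: ((clopen_sub Aq Apq).2 _ _ tq) => b bq; apply/holdsU; right.
- by apply: ((clopen_sub Ap Apq).2 _ _ tp) => b bp; apply/holdsU; left.
have [tp|tNp] := ctype_compl (svalP t) Ap; first by left.
right; apply: (@ctype_deduction t [:: FOr p q; FNot p]) => // [r|b bs].
  by rewrite !inE => /orP[] /eqP->.
have /holdsN bNp : holds b (FNot p) by apply: bs; rewrite !inE eqxx orbT.
by have /holdsU[] : holds b (FOr p q) by apply: bs; rewrite !inE eqxx.
Qed.

Lemma clopenI p q : formula_over A p -> formula_over A q ->
  ⟦FAnd p q⟧ = ⟦p⟧ `&` ⟦q⟧.
Proof.
move=> Ap Aq; have Apq := formula_overI Ap Aq.
apply/seteqP; split=> [t tpq|t [tp tq]]; last first.
  apply: (@ctype_deduction t [:: p; q]) => // [r|b bs].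
    by rewrite !inE => /orP[] /eqP->.
  by apply/holdsI; split; apply: bs; rewrite !inE eqxx ?orbT.
split; first by apply: ((clopen_sub Apq Ap).2 _ _ tpq) => b /holdsI[].
by apply: ((clopen_sub Apq Aq).2 _ _ tpq) => b /holdsI[].
Qed.

Lemma open_clopen p : formula_over A p -> open ⟦p⟧.
Proof.
move=> Ap; exists [set ⟦p⟧]; last by rewrite bigcup_set1.
move=> _ ->; exists [fset p]%fset; first by move=> r; rewrite inE => /eqP->; exact/mem_set.
by rewrite set_fset1 bigcap_set1.
Qed.

(** The topology is given by a subbase; a finite intersection of its members is the clopen set of a
    conjunction, so the subbase is already a base. *)
Lemma open_clopen_basis (O : set (ctype A Y)) t : open O -> O t ->
  exists p, [/\ formula_over A p, ⟦p⟧ t & ⟦p⟧ `<=` O].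
Proof.
move=> [D finD <-] [B DB Bt]; have [F FA BE] := finD _ DB; rewrite -BE in Bt.
have [p [Ap pE]] : exists p, formula_over A p /\
    ⟦p⟧ = \bigcap_(r in [set` F]) ⟦r⟧.
  rewrite bigcap_fset; move: FA.
  have : forall r, r \in enum_fset F -> r \in F by [].
  elim: (enum_fset F) => [|r s IH] sF FA.
    by exists FTrue; rewrite big_nil clopenT; split=> //; exact: formula_overT.
  have [|//|p [Ap pE]] := IH; first by move=> x xs; apply: sF; rewrite inE xs orbT.
  have Ar : formula_over A r.
    exact: set_mem (FA r (sF r (mem_head _ _))).
  exists (FAnd r p); split; first exact: formula_overI.
  by rewrite big_cons clopenI// pE.
exists p; split=> //; first by rewrite pE.
by rewrite pE => t' Ft'; exists B => //; rewrite -BE.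
Qed.

(** An ultrafilter [F] converges to the type [Q] of all formulas whose clopen set belongs to [F]. A
    finite part of [Q] is satisfiable because some type contains it. *)
Lemma ctype_compact : compact [set: ctype A Y].
Proof.
rewrite compact_ultra => F UF _.
pose Q : set form := [set p | formula_over A p /\ F ⟦p⟧].
have QP : is_ctype A Q.
  split=> [p []//|s sQ|p Ap].
    have /filter_ex[t tP] : F (\bigcap_(p in [set` s]) ⟦p⟧).
      elim: s sQ => [|p s IH] sQ; first by rewrite set_nil bigcap_set0; exact: filterT.
      apply: (@filterS _ F _ (⟦p⟧ `&` \bigcap_(r in [set` s]) ⟦r⟧)).
        by move=> t [tp ts] r /=; rewrite inE => /predU1P[->|/ts].
      apply: filterI.
        by have [] := sQ p (mem_head _ _).
      by apply: IH => r rs; apply: sQ; rewrite inE rs orbT.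
    by have := ctype_fsat (svalP t) (s := s); apply.
  have [Fp|FNp] := in_ultra_setVsetC ⟦p⟧ UF; first by left.
  by right; split; [exact: formula_overN|rewrite clopenN].
exists (exist _ Q QP : ctype A Y); split=> // V /=.
rewrite nbhsE /= => -[W [oW /(open_clopen_basis oW)[p [Ap [_ Fp] pW]]] WV].
by apply: filterS Fp => x /pW/WV.
Qed.

(** By compactness finitely many clopen sets inside [O] cover [C], and their union is the clopen set
    of a disjunction. *)
Lemma clopen_between (C O : set (ctype A Y)) : closed C -> open O -> C `<=` O ->
  exists p, [/\ formula_over A p, C `<=` ⟦p⟧ & ⟦p⟧ `<=` O].
Proof.
move=> cC oO CO.
have := subclosed_compact cC ctype_compact (fun _ _ => I).
rewrite compact_cover => /(_ form [set p | formula_over A p /\ ⟦p⟧ `<=` O]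
  (@ctype_clopen L U A Y))[|t /CO /(open_clopen_basis oO)[p [Ap tp pO]]|].
- by move=> p [Ap _]; exact: open_clopen.
- by exists p.
move=> D DO CD.
have [p [Ap pE]] : exists p, formula_over A p /\
    ⟦p⟧ = \bigcup_(r in [set` D]) ⟦r⟧.
  rewrite bigcup_fset; move: DO.
  have : forall r, r \in enum_fset D -> r \in D by [].
  elim: (enum_fset D) => [|r s IH] sD DO.
    exists (FNot FTrue); rewrite big_nil clopenN ?clopenT ?setCT; last exact: formula_overT.
    by split; first by apply: formula_overN; exact: formula_overT.
  have [|//|p [Ap pE]] := IH; first by move=> x xs; apply: sD; rewrite inE xs orbT.
  have Ar : formula_over A r.
    by case: (set_mem (DO r (sD r (mem_head _ _)))).
  exists (FOr r p); split; first exact: formula_overU.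
  by rewrite big_cons clopenU// pE.
exists p; split; rewrite ?pE// => t [r /= rD tr].
by have [_] := set_mem (DO r rD); apply.
Qed.

Lemma closed_clopen p : formula_over A p -> closed ⟦p⟧.
Proof.
move=> Ap; rewrite -[⟦p⟧]setCK -(clopenN Ap); apply: open_closedC.
by apply: open_clopen; apply: formula_overN.
Qed.

(** This is the compactness step that turns finite subadditivity into countable subadditivity on
    open sets. *)
Lemma clopen_finite_subcover (p : form) (O : nat -> set (ctype A Y)) :
  formula_over A p -> (forall i, open (O i)) -> ⟦p⟧ `<=` \bigcup_i O i ->
  exists n, ⟦p⟧ `<=` \bigcup_(i < n) O i.
Proof.
move=> Ap oO pO.
have := subclosed_compact (closed_clopen Ap) ctype_compact (fun _ _ => I).
rewrite compact_cover => /(_ nat setT O)[//|//|D _ pD].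
have [n Dn] : exists n, forall i, i \in D -> (i < n)%N.
  exists (\max_(i <- enum_fset D) i).+1 => i iD.
  by rewrite ltnS; apply: leq_bigmax_seq.
by exists n => t /pD[i /= iD Oi]; exists i => //=; apply: Dn.
Qed.

End TypeSpace.

(** * Keisler measures and their regular Borel extensions *)

Section KeislerTheory.
Variables (R : realType) (L : language) (U : structure L) (X : Type).
Variables (nu : formula L (X + U) -> R) (nuK : keisler_measure nu).

Lemma keisler_split p q : nu p = nu (FAnd p q) + nu (FAnd p (FNot q)).
Proof.
rewrite -(keisler_add nuK) => [|[a /holdsI[/holdsI[_ aq] /holdsI[_]]]]; last first.
  by move=> /holdsN.
apply: (keisler_equiv nuK) => a; rewrite holdsU !holdsI holdsN.
by split=> [ap|[] []//]; have [|] := pselect (holds a q); [left|right].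
Qed.

Lemma keisler_le p q : (forall a, holds a p -> holds a q) -> nu p <= nu q.
Proof.
move=> pq; rewrite (keisler_split q p) (keisler_equiv nuK (p := FAnd q p) (q := p)).
  by rewrite lerDl (keisler_ge0 nuK).
by move=> a; rewrite holdsI; split=> [[]//|ap]; split=> //; apply: pq.
Qed.

Lemma keisler_all p : (forall a, holds a p) -> nu p = 1.
Proof.
move=> allp; rewrite -(keisler_true nuK); apply: (keisler_equiv nuK) => a.
by split=> // _; apply: holdsT.
Qed.

Lemma keisler_not p : nu (FNot p) = 1 - nu p.
Proof.
apply/eqP; rewrite eq_sym subr_eq addrC -(keisler_add nuK) => [|[a /holdsI[]]]; last first.
  by move=> ap /holdsN.
apply/eqP/esym/keisler_all => a; rewrite holdsU holdsN.
exact: EM.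
Qed.

Lemma keisler_le1 p : nu p <= 1.
Proof. by rewrite -subr_ge0 -keisler_not (keisler_ge0 nuK). Qed.

Lemma keisler_none p : ~ consistent p -> nu p = 0.
Proof.
move=> np; rewrite -[nu p]opprK -[- nu p](addKr 1) -keisler_not keisler_all.
  by rewrite addNr oppr0.
by move=> a; apply/holdsN => ap; apply: np; exists a.
Qed.

(** Bonferroni's inequality: the part of [p] outside [q] is disjoint from [q], so these two have
    total measure at most 1. *)
Lemma keisler_FAnd_ge p q : nu p + nu q - 1 <= nu (FAnd p q).
Proof.
rewrite lerBlDr (keisler_split p q) -addrA lerD2l addrC.
rewrite -(keisler_add nuK) ?keisler_le1// => -[a].
by rewrite !holdsI holdsN => -[? []].
Qed.

End KeislerTheory.

Section RegularExtension.
Variables (R : realType) (L : language) (U : structure L) (A : set U) (Y : Type).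
Variables (nu : formula L (Y + U) -> R) (nuK : keisler_measure nu).
Local Notation "⟦ p ⟧" := (@ctype_clopen L U A Y p) (format "⟦ p ⟧").
Local Open Scope ereal_scope.

(** First half of a Riesz-type extension: open sets are measured from inside by clopen sets, then
    arbitrary sets from outside by open sets. *)
Definition open_content (V : set (ctype A Y)) : \bar R :=
  ereal_sup [set (nu p)%:E | p in [set p | formula_over A p /\ ⟦p⟧ `<=` V]].

(* The language may be uncountable, so the clopen sets need not generate the
   Borel sets: covers by one open set replace countable covers by clopen sets. *)
Definition regular_outer (E : set (ctype A Y)) : \bar R :=
  ereal_inf [set open_content V | V in [set V | open V /\ E `<=` V]].

Lemma le_open_content V W : V `<=` W -> open_content V <= open_content W.
Proof.
move=> VW; apply: ge_ereal_sup => _ [p [Ap pV] <-].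
by apply: ereal_sup_ubound; exists p => //; split=> //; apply: subset_trans VW.
Qed.

Lemma open_content_ge V p : formula_over A p -> ⟦p⟧ `<=` V -> (nu p)%:E <= open_content V.
Proof. by move=> Ap pV; apply: ereal_sup_ubound; exists p. Qed.

Lemma open_content_le V x : (forall p, formula_over A p -> ⟦p⟧ `<=` V -> (nu p)%:E <= x) ->
  open_content V <= x.
Proof. by move=> H; apply: ge_ereal_sup => _ [p [Ap pV] <-]; apply: H. Qed.

Lemma open_content_clopen p : formula_over A p -> open_content ⟦p⟧ = (nu p)%:E.
Proof.
move=> Ap; apply/eqP; rewrite eq_le open_content_ge// andbT.
apply: open_content_le => q Aq /(clopen_sub Aq Ap) qp.
by rewrite lee_fin keisler_le.
Qed.

Lemma formula_over_false : formula_over A (@FFalse L (Y + U)).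
Proof. by move=> u []. Qed.

Lemma clopen_false : ⟦FFalse⟧ = set0.
Proof.
apply/seteqP; split=> // t tF.
have [p|b bF] := ctype_fsat (svalP t) (s := [:: FFalse]).
  by rewrite inE => /eqP->.
exact: bF (mem_head _ _).
Qed.

Lemma keisler_false : nu FFalse = 0%R.
Proof. by rewrite (keisler_none nuK)// => -[]. Qed.

Lemma open_content_ge0 V : 0 <= open_content V.
Proof.
apply: le_trans (open_content_ge formula_over_false _); first by rewrite keisler_false.
by rewrite clopen_false.
Qed.

Lemma open_content0 : open_content set0 = 0.
Proof.
by rewrite -clopen_false open_content_clopen ?keisler_false//; apply: formula_over_false.
Qed.

Lemma open_content_le1 V : open_content V <= 1.
Proof. by apply: open_content_le => p _ _; rewrite lee_fin keisler_le1. Qed.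

Lemma open_content_fin V : open_content V \is a fin_num.
Proof.
rewrite ge0_fin_numE ?open_content_ge0//.
by apply: le_lt_trans (open_content_le1 _) _; rewrite ltry.
Qed.

(** A clopen set [p] inside the union is cut by a clopen [q] that separates the closed set of points
    of [p] outside [W] from the complement of [V]. Then [q] lies in [V], and the rest of [p] lies in
    [W]. *)
Lemma open_contentU V W : open V -> open W ->
  open_content (V `|` W) <= open_content V + open_content W.
Proof.
move=> oV oW; apply: open_content_le => p Ap pVW.
have [||t|q [Aq Cq qV]] := @clopen_between L U A Y (⟦p⟧ `\` W) V.
- rewrite setDE; apply: closedI; [exact: closed_clopen|exact: open_closedC].
- by [].
- by move=> [/pVW[]].
have Apq : formula_over A (FAnd p (FNot q)) by apply: formula_overI => //; apply: formula_overN.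
apply: le_trans (leeD (open_content_ge Aq qV) (open_content_ge Apq _)).
  rewrite -EFinD lee_fin (keisler_split nuK p q) lerD2r.
  by apply: keisler_le => // a /holdsI[].
rewrite clopenI//; last exact: formula_overN.
by rewrite clopenN// => t [tp tNq]; apply: contrapT => tNW; apply: tNq; apply: Cq.
Qed.

Lemma open_content_bigsetU n (V : nat -> set (ctype A Y)) : (forall i, open (V i)) ->
  open_content (\big[setU/set0]_(i < n) V i) <= \sum_(i < n) open_content (V i).
Proof.
move=> oV; elim: n => [|n IH]; first by rewrite !big_ord0 open_content0.
rewrite !big_ord_recr/=; apply: le_trans (open_contentU _ _) _ => //.
  by rewrite -bigcup_mkord; apply: bigcup_open.
by apply: leeD.
Qed.

Lemma open_content_bigcup (V : nat -> set (ctype A Y)) : (forall i, open (V i)) ->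
  open_content (\bigcup_i V i) <= \sum_(i <oo) open_content (V i).
Proof.
move=> oV; apply: open_content_le => p Ap pV.
have [n pVn] := clopen_finite_subcover Ap oV pV.
rewrite bigcup_mkord in pVn.
apply: le_trans (open_content_ge Ap pVn) _.
apply: le_trans (open_content_bigsetU _ oV) _.
rewrite -(big_mkord xpredT (fun i => open_content (V i))).
by apply: nneseries_lim_ge => *; apply: open_content_ge0.
Qed.

Lemma regular_outer_open V : open V -> regular_outer V = open_content V.
Proof.
move=> oV; apply/eqP; rewrite eq_le; apply/andP; split.
  by apply: ereal_inf_lbound; exists V => //; split.
by apply: le_ereal_inf_tmp => _ [W [oW VW] <-]; apply: le_open_content.
Qed.

Lemma regular_outer_le E V : open V -> E `<=` V -> regular_outer E <= open_content V.
Proof. by move=> oV EV; apply: ereal_inf_lbound; exists V => //; split. Qed.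

Lemma regular_outer0 : regular_outer set0 = 0.
Proof. by rewrite regular_outer_open ?open_content0//; exact: open0. Qed.

Lemma regular_outer_ge0 E : 0 <= regular_outer E.
Proof. by apply: le_ereal_inf_tmp => _ [V _ <-]; apply: open_content_ge0. Qed.

Lemma le_regular_outer : {homo regular_outer : E F / E `<=` F >-> E <= F}.
Proof.
move=> E F EF; apply: le_ereal_inf_tmp => _ [V [oV FV] <-].
by apply: regular_outer_le => //; apply: subset_trans FV.
Qed.

Lemma regular_outer_fin E : regular_outer E \is a fin_num.
Proof.
rewrite ge0_fin_numE ?regular_outer_ge0//.
apply: le_lt_trans (regular_outer_le openT (@subsetT _ _)) _.
by apply: le_lt_trans (open_content_le1 _) _; rewrite ltry.
Qed.

Lemma regular_outer_approx E (e : R) : (0 < e)%R ->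
  exists V, [/\ open V, E `<=` V & open_content V <= regular_outer E + e%:E].
Proof.
move=> e0; have [_ [V [oV EV] <-] /ltW] := lb_ereal_inf_adherent e0 (regular_outer_fin E).
by exists V.
Qed.

Lemma regular_outer_sigma_subadditive : sigma_subadditive regular_outer.
Proof.
move=> E; apply/lee_addgt0Pr => e e0.
pose d n : R := (e / (2 ^ n.+1)%:R)%R.
have d0 n : (0 < d n)%R by rewrite divr_gt0// ltr0n expn_gt0.
have /choice[V VP] : forall n, exists V, [/\ open V, E n `<=` V &
    open_content V <= regular_outer (E n) + (d n)%:E].
  by move=> n; apply: regular_outer_approx.
have oV n : open (V n) by have [] := VP n.
apply: (@le_trans _ _ (open_content (\bigcup_n V n))).
  apply: regular_outer_le; first exact: bigcup_open.
  by apply: subset_bigcup => n _; have [] := VP n.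
apply: le_trans (open_content_bigcup oV) _.
apply: (@le_trans _ _ (\sum_(n <oo) (regular_outer (E n) + (d n)%:E))).
  apply: lee_nneseries => [n _ _|n _]; first exact: open_content_ge0.
  by have [] := VP n.
by apply: epsilon_trick => [n|]; [exact: regular_outer_ge0|exact: ltW].
Qed.

(** The argument carries the proof that [nu] is a Keisler measure, from which the outer measure
    instance is built. *)
Definition regular_outer_measure of keisler_measure nu := regular_outer.

HB.instance Definition _ := isOuterMeasure.Build R (ctype A Y) (regular_outer_measure nuK)
  regular_outer0 regular_outer_ge0 le_regular_outer regular_outer_sigma_subadditive.

(** Replace [E] by a nearly optimal open [W]. Nearly optimal clopen sets [p] inside [W] and [V],
    then [q] inside [W] minus [p], are disjoint, so their measures add up to at most the content of
    [W]. Each of the three approximations costs [e / 3]. *)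
Lemma open_caratheodory V : open V -> (regular_outer_measure nuK).-caratheodory V.
Proof.
move=> oV; apply: le_caratheodory_measurable => E.
apply/lee_addgt0Pr => e e0.
have e30 : (0 < e / 3)%R by rewrite divr_gt0.
have [W [oW EW WE]] := regular_outer_approx E e30.
have approx Z : exists p, [/\ formula_over A p, ⟦p⟧ `<=` Z &
    open_content Z <= (nu p + e / 3)%:E].
  have [_ [p [Ap pZ] <-]] := ub_ereal_sup_adherent e30 (open_content_fin Z).
  by rewrite lteBlDr// => /ltW Zp; exists p; split=> //; rewrite EFinD.
have [p [Ap pWV Wp]] := approx (W `&` V).
(* The complement of [p] replaces that of [V]: it is open, and it still contains the part of [E]
   outside [V]. *)
have [q [Aq qWp Wq]] := approx (W `&` ~` ⟦p⟧).
have Apq := formula_overU Ap Aq.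
have pqW : (nu p + nu q)%:E <= open_content W.
  rewrite -(keisler_add nuK) => [|[b /holdsI[bp bq]]].
    apply: open_content_ge => //; rewrite clopenU// => t [/pWV[]//|/qWp[]//].
  have : ⟦q⟧ (tp A b) by [].
  by case/qWp => _ /=; apply.
have EV : regular_outer (E `&` V) <= (nu p + e / 3)%:E.
  apply: le_trans (regular_outer_le (openI oW oV) _) Wp.
  exact: setSI.
have ENV : regular_outer (E `&` ~` V) <= (nu q + e / 3)%:E.
  apply: le_trans (regular_outer_le _ _) Wq.
    by apply: openI => //; rewrite -clopenN//; apply: open_clopen; apply: formula_overN.
  by move=> t [/EW Wt tNV]; split=> // /pWV[].
apply: le_trans (leeD EV ENV) _.
rewrite -EFinD addrACA EFinD; apply: le_trans (leeD2r _ pqW) _.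
apply: le_trans (leeD2r _ WE) _.
rewrite -addeA -EFinD leeD2l// lee_fin; lra.
Qed.

End RegularExtension.

Section RestrictionExists.
Variables (R : realType) (L : language) (U : structure L) (A : set U) (Y : Type).
Variables (nu : formula L (Y + U) -> R) (nuK : keisler_measure nu).
Local Open Scope ereal_scope.

Definition regular_extension of keisler_measure nu : set (borel_ctype A Y) -> \bar R :=
  @regular_outer R L U A Y nu.
Local Notation P := (regular_extension nuK).

Let borel_caratheodory (E : set (borel_ctype A Y)) : measurable E ->
  (@regular_outer_measure R L U A Y nu nuK).-caratheodory E.
Proof.
move: E; apply: smallest_sub; last by move=> V; exact: open_caratheodory.
split=> [|E cE|E cE].
- exact: caratheodory_measurable_set0.
- by rewrite setTD; apply: caratheodory_measurable_setC.
- exact: caratheodory_measurable_bigcup.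
Qed.

Let regular_extension0 : P set0 = 0.
Proof. exact: (regular_outer0 A nuK). Qed.

Let regular_extension_ge0 E : 0 <= P E.
Proof. exact: (regular_outer_ge0 nuK). Qed.

Let regular_extension_sigma_additive : semi_sigma_additive P.
Proof.
move=> E mE tE mbigE.
apply: (@caratheodory_measure_sigma_additive R (ctype A Y)
  (regular_outer_measure nuK) E _ tE) => [i|].
  exact: borel_caratheodory (mE i).
exact: borel_caratheodory mbigE.
Qed.

HB.instance Definition _ := isMeasure.Build _ (borel_ctype A Y) R P
  regular_extension0 regular_extension_ge0 regular_extension_sigma_additive.

Let regular_extension_clopen p : formula_over A p ->
  P (@ctype_clopen L U A Y p) = (nu p)%:E.
Proof.
move=> Ap; rewrite /regular_extension regular_outer_open; last exact: open_clopen.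
exact: open_content_clopen.
Qed.

Let regular_extensionT : P setT = 1.
Proof.
rewrite -[setT](@clopenT L U A Y) regular_extension_clopen ?(keisler_true nuK)//.
exact: formula_overT.
Qed.

HB.instance Definition _ := Measure_isProbability.Build _ (borel_ctype A Y) R P
  regular_extensionT.

(** Outer regularity is built in: the measure of a set is the infimum of the contents of its open
    supersets. *)
Lemma restriction_exists :
  exists P : probability (borel_ctype A Y) R, is_restriction nu P.
Proof.
exists (regular_extension nuK); split; first exact: regular_extension_clopen.
move=> E mE; rewrite /= /regular_extension {1}/regular_outer.
congr ereal_inf; apply/seteqP; split=> _ [V [oV EV] <-]; exists V => //;
  by rewrite regular_outer_open.
Qed.

End RestrictionExists.

(** * Small sets stay small after adding finitely many points *)

(** Hilbert's hotel: along an injective sequence [f] in [A], the first terms are sent onto [F] and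
    the later ones are shifted back, so [g] maps [A] onto the union. *)
Lemma card_le_setU_finite (S : Type) (A F : set S) :
  infinite_set A -> finite_set F -> (A `|` F #<= A)%card.
Proof.
move=> /infiniteP/card_leP[f0] /(@finite_seqP {classic S})[s sE].
pose f n : S := val (f0 (exist _ n (mem_set (I : [set: nat] n)))).
have fI : injective f.
  move=> m n /val_inj /(@inj _ _ _ f0 _ _ (mem_set I) (mem_set I)).
  by move=> /(congr1 val).
have fA n : A (f n) by apply: set_mem (valP (f0 _)).
pose g (x : S) : S := if pselect (exists n, f n = x) is left fx
  then (fun n => if (n < size s)%N then @nth {classic S} x s n else f (n - size s)%N)
    (projT1 (cid fx)) else x.
have gf n : g (f n) = if (n < size s)%N then @nth {classic S} (f n) s n
                      else f (n - size s)%N.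
  rewrite /g; case: pselect => [fx|[]]; last by exists n.
  by case: cid => m /= /fI ->.
apply: card_le_trans (card_image_le g A); apply: subset_card_le => x [Ax|].
  have [[n nx]|nfx] := pselect (exists n, f n = x).
    exists (f (n + size s)%N) => //.
    by rewrite gf ltnNge leq_addl/= addnK.
  by exists x => //; rewrite /g; case: pselect.
rewrite sE => /= xs; exists (f (@index {classic S} x s)) => //.
by rewrite gf index_mem xs; exact: (@nth_index {classic S}).
Qed.

(** Morley products are computed over [M] together with the parameters of a formula; saturation
    requires this base to be small. When [A] is finite, the union is compared with [nat] instead. *)
Lemma smaller_setU_finite (S : Type) (A F : set S) (K : Type) :
  smaller [set: nat] K -> smaller A K -> finite_set F -> smaller (A `|` F) K.
Proof.
move=> [natK Knat] [AK KA] finF.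
have [finA|infA] := pselect (finite_set A).
  have AFnat : (A `|` F #<= [set: nat])%card.
    by apply: finite_set_countable; rewrite finite_setU.
  split; first exact: card_le_trans AFnat natK.
  by move=> /card_le_trans/(_ AFnat).
have AFA := card_le_setU_finite infA finF.
split; first exact: card_le_trans AFA AK.
by move=> /card_le_trans/(_ AFA).
Qed.

(** * Finitely additive integration *)

Section StepFunctions.
Variables (R : realType) (L : language) (U : structure L) (X : Type).
Implicit Types (s : seq (R * formula L (X + U))) (nu : formula L (X + U) -> R).

Definition indic_formula (p : formula L (X + U)) (a : X -> U) : R :=
  (`[< holds a p >])%:R.

Definition step_val s (a : X -> U) : R := \sum_(cp <- s) cp.1 * indic_formula cp.2 a.

Definition step_int nu s : R := \sum_(cp <- s) cp.1 * nu cp.2.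

Lemma indic_formula1 p a : holds a p -> indic_formula p a = 1.
Proof. by move=> ap; rewrite /indic_formula; case: asboolP. Qed.

Lemma indic_formula0 p a : ~ holds a p -> indic_formula p a = 0.
Proof. by move=> ap; rewrite /indic_formula; case: asboolP. Qed.

(* Splitting along the first formula reduces positivity to a shorter sum. *)
Lemma step_int_ge0_on nu s (c : R) (q : formula L (X + U)) : keisler_measure nu ->
  (forall a, holds a q -> 0 <= c + step_val s a) ->
  0 <= c * nu q + \sum_(cp <- s) cp.1 * nu (FAnd cp.2 q).
Proof.
move=> nuK; elim: s c q => [|[d p] s IH] c q pos.
  rewrite big_nil addr0.
  have [[a aq]|nq] := pselect (consistent q).
    apply: mulr_ge0; last exact: (keisler_ge0 nuK).
    by have := pos a aq; rewrite /step_val big_nil addr0.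
  by rewrite (keisler_none nuK nq) mulr0.
have IH1 : 0 <= (c + d) * nu (FAnd q p) + \sum_(cp <- s) cp.1 * nu (FAnd cp.2 (FAnd q p)).
  apply: IH => a /holdsI[aq ap]; have := pos a aq.
  by rewrite /step_val big_cons /= indic_formula1// mulr1 addrA.
have IH2 : 0 <= c * nu (FAnd q (FNot p)) +
    \sum_(cp <- s) cp.1 * nu (FAnd cp.2 (FAnd q (FNot p))).
  apply: IH => a /holdsI[aq ap]; have := pos a aq.
  by rewrite /step_val big_cons /= indic_formula0// mulr0 add0r.
have := addr_ge0 IH1 IH2; rewrite big_cons/= addrACA -big_split /=.
have -> : nu (FAnd p q) = nu (FAnd q p).
  by apply: (keisler_equiv nuK) => a; rewrite !holdsI; split=> -[].
rewrite (keisler_split nuK q p) mulrDl mulrDr.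
under eq_bigr => cp _ do rewrite -mulrDr.
set S1 := \sum_(i <- s) _; set S2 := \sum_(i <- s) _.
have -> : S1 = S2.
  apply: eq_bigr => cp _; congr (_ * _).
  rewrite [RHS](keisler_split nuK _ p); congr (_ + _); apply: (keisler_equiv nuK) => a;
    by rewrite !holdsI; split=> [[? []]|[[]]].
by move=> h; apply: le_trans h _; rewrite le_eqVlt; apply/orP; left; apply/eqP; ring.
Qed.

Lemma step_int_ge0 nu s : keisler_measure nu ->
  (forall a, 0 <= step_val s a) -> 0 <= step_int nu s.
Proof.
move=> nuK pos; have := @step_int_ge0_on nu s 0 FTrue nuK.
rewrite mul0r add0r /step_int => H.
rewrite (eq_bigr (fun cp => cp.1 * nu (FAnd cp.2 FTrue))).
  by apply: H => a _; rewrite add0r.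
move=> cp _; congr (_ * _); apply: (keisler_equiv nuK) => a.
by rewrite holdsI; split=> [|[]//]; split=> //; exact: holdsT.
Qed.

Lemma step_val_cat s1 s2 a : step_val (s1 ++ s2) a = step_val s1 a + step_val s2 a.
Proof. by rewrite /step_val big_cat. Qed.

Lemma step_int_cat nu s1 s2 : step_int nu (s1 ++ s2) = step_int nu s1 + step_int nu s2.
Proof. by rewrite /step_int big_cat. Qed.

Definition step_scale (c : R) s := [seq (c * cp.1, cp.2) | cp <- s].

Lemma step_val_scale c s a : step_val (step_scale c s) a = c * step_val s a.
Proof. by rewrite /step_val big_map mulr_sumr; apply: eq_bigr => cp _; rewrite mulrA. Qed.

Lemma step_int_scale nu c s : step_int nu (step_scale c s) = c * step_int nu s.
Proof. by rewrite /step_int big_map mulr_sumr; apply: eq_bigr => cp _; rewrite mulrA. Qed.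

Definition step_const (c : R) : seq (R * formula L (X + U)) := [:: (c, FTrue)].

Lemma step_val_const c a : step_val (step_const c) a = c.
Proof. by rewrite /step_val big_seq1 /= indic_formula1 ?mulr1//; exact: holdsT. Qed.

Lemma step_int_const nu c : keisler_measure nu -> step_int nu (step_const c) = c.
Proof. by move=> nuK; rewrite /step_int big_seq1 /= (keisler_true nuK) mulr1. Qed.

Lemma step_int_le nu s1 s2 c : keisler_measure nu ->
  (forall a, step_val s1 a <= step_val s2 a + c) -> step_int nu s1 <= step_int nu s2 + c.
Proof.
move=> nuK le12.
have := @step_int_ge0 nu (s2 ++ step_const c ++ step_scale (-1) s1) nuK.
rewrite !step_int_cat step_int_const// step_int_scale mulN1r addrA subr_ge0; apply => a.
by rewrite !step_val_cat step_val_const step_val_scale mulN1r addrA subr_ge0.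
Qed.

(** Integration of uniform limits of step functions against a finitely additive measure, directly on
    tuples of [U] and without passing to types. *)
Definition is_integral nu (f : (X -> U) -> R) (I : R) : Prop :=
  forall e, 0 < e -> exists s, (forall a, `|f a - step_val s a| <= e) /\
                               `|I - step_int nu s| <= e.

(** By monotonicity the error bound holds for every step function close to [f], not only for those
    supplied by the definition. One step function can therefore serve several measures. *)
Lemma is_integral_step nu f I s e : keisler_measure nu -> is_integral nu f I ->
  (forall a, `|f a - step_val s a| <= e) -> `|I - step_int nu s| <= e.
Proof.
move=> nuK fI fs; apply/ler_addgt0Pr => d d0.
have d20 : 0 < d / 2 by rewrite divr_gt0.
have [s' [fs' Is']] := fI _ d20.
have le1 : step_int nu s' <= step_int nu s + (e + d / 2).
  apply: step_int_le => // a; have := fs a; have := fs' a.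
  by rewrite !ler_norml => /andP[? ?] /andP[? ?]; lra.
have le2 : step_int nu s <= step_int nu s' + (e + d / 2).
  apply: step_int_le => // a; have := fs a; have := fs' a.
  by rewrite !ler_norml => /andP[? ?] /andP[? ?]; lra.
by move: Is'; rewrite !ler_norml => /andP[? ?]; apply/andP; split; lra.
Qed.

Lemma le_is_integral nu f g I J : keisler_measure nu -> is_integral nu f I ->
  is_integral nu g J -> (forall a, f a <= g a) -> I <= J.
Proof.
move=> nuK fI gJ fg; apply/ler_addgt0Pr => d d0.
have d40 : 0 < d / 4 by rewrite divr_gt0.
have [s [fs Is]] := fI _ d40; have [t [gt Jt]] := gJ _ d40.
have le1 : step_int nu s <= step_int nu t + (d / 2).
  apply: step_int_le => // a; have := fs a; have := gt a; have := fg a.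
  by rewrite !ler_norml => ? /andP[? ?] /andP[? ?]; lra.
by move: Is Jt; rewrite !ler_norml => /andP[? ?] /andP[? ?]; lra.
Qed.

Lemma is_integral_unique nu f I J : keisler_measure nu -> is_integral nu f I ->
  is_integral nu f J -> I = J.
Proof.
move=> nuK fI fJ; apply/le_anti/andP.
by split; [apply: (le_is_integral nuK fI fJ)|apply: (le_is_integral nuK fJ fI)].
Qed.

Lemma is_integral_step_val nu s : is_integral nu (step_val s) (step_int nu s).
Proof. by move=> e e0; exists s; split=> [a|]; rewrite subrr normr0 ltW. Qed.

Lemma is_integral_cst nu c : keisler_measure nu -> is_integral nu (fun=> c) c.
Proof.
move=> nuK; have := is_integral_step_val nu (step_const c).
rewrite step_int_const//; congr (is_integral _ _ _).
by apply/funext => a; rewrite step_val_const.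
Qed.

Lemma is_integral_indic nu p : is_integral nu (indic_formula p) (nu p).
Proof.
have := is_integral_step_val nu [:: (1, p)].
rewrite /step_int big_seq1 mul1r; congr (is_integral _ _ _).
by apply/funext => a; rewrite /step_val big_seq1 mul1r.
Qed.

Lemma is_integralD nu f g I J : is_integral nu f I -> is_integral nu g J ->
  is_integral nu (fun a => f a + g a) (I + J).
Proof.
move=> fI gJ e e0; have e20 : 0 < e / 2 by rewrite divr_gt0.
have [s [fs Is]] := fI _ e20; have [t [gt Jt]] := gJ _ e20.
exists (s ++ t); rewrite step_int_cat; split=> [a|].
  rewrite step_val_cat opprD addrACA (le_trans (ler_normD _ _))//.
  by have := fs a; have := gt a; lra.
by rewrite opprD addrACA (le_trans (ler_normD _ _))//; lra.
Qed.

Lemma is_integralZ nu c f I : is_integral nu f I ->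
  is_integral nu (fun a => c * f a) (c * I).
Proof.
move=> fI e e0; have d0 : 0 < e / (1 + `|c|) by rewrite divr_gt0// ltr_pwDl.
have [s [fs Is]] := fI _ d0.
have bound x : `|x| <= e / (1 + `|c|) -> `|c * x| <= e.
  rewrite ler_pdivlMr ?ltr_pwDl// normrM; apply: le_trans.
  by rewrite mulrDr mulr1 mulrC lerDr.
exists (step_scale c s); rewrite step_int_scale -mulrBr.
by split=> [a|]; rewrite ?step_val_scale -?mulrBr; exact: bound.
Qed.

End StepFunctions.

(** * Integrals of uniform limits against a probability measure *)

Section UniformApproximation.
Context (d : measure_display) (T : measurableType d) (R : realType).
Variables (P : probability T R) (F : T -> R).
Hypothesis approx : forall e, 0 < e -> exists g : T -> R,
  P.-integrable setT (EFin \o g) /\ forall x, `|F x - g x| <= e.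

Lemma uniform_limit_measurable : measurable_fun setT F.
Proof.
have /choice[g gP] : forall n : nat, exists g : T -> R,
    P.-integrable setT (EFin \o g) /\ forall x, `|F x - g x| <= n.+1%:R^-1.
  by move=> n; apply: approx; rewrite invr_gt0.
apply: (@measurable_fun_cvg _ _ _ setT g) => [n|x _].
  by apply/measurable_EFinP; apply: measurable_int (gP n).1.
apply/cvgrPdist_le => e e0; near=> n.
apply: le_trans ((gP n).2 x) _.
by apply: ltW; near: n; exact: near_infty_natSinv_lt (PosNum e0).
Unshelve. all: by end_near. Qed.

Lemma uniform_limit_integrable : P.-integrable setT (EFin \o F).
Proof.
have [g [gi Fg]] := approx ltr01.
have mF := uniform_limit_measurable.
have mg : measurable_fun setT g by apply/measurable_EFinP; apply: measurable_int gi.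
have c1i := finite_measure_integrable_cst P 1 (@measurableT _ T).
have Fgi : P.-integrable setT (EFin \o (fun x => F x - g x)).
  apply: le_integrable c1i => //.
    by apply/measurable_EFinP; apply: measurable_funB.
  by move=> x _; rewrite /= lee_fin normr1.
have := integrableD measurableT Fgi gi; apply: eq_integrable => // x _ /=.
by rewrite -EFinD subrK.
Qed.

(** The total mass is 1, so a uniform error [e] costs at most [e] in the integral. The integral of
    [F] is finite and is returned as a real [r], the form in which [morley] extracts it. *)
Lemma uniform_limit_integral (g : T -> R) (I e : R) : 0 <= e ->
  P.-integrable setT (EFin \o g) -> (forall x, `|F x - g x| <= e) ->
  (\int[P]_x (g x)%:E = I%:E)%E ->
  exists2 r, (\int[P]_x (F x)%:E = r%:E)%E & `|r - I| <= e.
Proof.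
move=> e0 gi Fg gI; have Fi := uniform_limit_integrable.
have /fineK Fr := integrable_fin_num measurableT Fi.
exists (fine (\int[P]_x (F x)%:E)); first by rewrite -Fr.
rewrite -lee_fin; set r := fine _.
have mFg : measurable_fun setT (EFin \o (fun x => F x - g x)).
  apply/measurable_EFinP; apply: measurable_funB; first exact: uniform_limit_measurable.
  by apply/measurable_EFinP; apply: measurable_int gi.
have -> : (`|r - I|%:E = `| \int[P]_x (F x - g x)%:E |)%E.
  under [in RHS]eq_integral do rewrite EFinB.
  by rewrite integralB// gI /= -Fr.
apply: le_trans (le_abse_integral P measurableT mFg) _.
apply: le_trans (@integral_le_bound _ _ _ P setT _ e%:E measurableT mFg _ _) _.
- by rewrite lee_fin.
- by apply: aeW => x _; rewrite /= lee_fin.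
- by rewrite [X in (_ * X)%E](_ : _ = 1%E) ?mule1//; exact: probability_setT.
Qed.

End UniformApproximation.

(** * Morley products *)

Section Morley.
Variables (R : realType) (L : language) (U : structure L).

Definition point_of (M : set U) (X : Type) := {a : X -> U | forall x, M (a x)}.

(* The weights are arbitrary reals, so that this property is closed under linear
   combinations. *)
Definition approximable (M : set U) (X : Type) (mu : formula L (X + U) -> R) :=
  forall (Y : finType) (p : formula L ((X + Y) + U)) (e : R), 0 < e ->
  exists s : seq (R * point_of M X), forall b : Y -> U,
    `|mu (inst p b) - \sum_(ca <- s) ca.1 * indic_formula R p (pairing (sval ca.2) b)| <= e.

Lemma approximable_comb (M : set U) (X : Type) (mu nu : formula L (X + U) -> R) (c d : R) :
  approximable M mu -> approximable M nu ->
  approximable M (fun p => c * mu p + d * nu p).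
Proof.
move=> muA nuA Y p e e0.
have k0 : 0 < e / (1 + `|c| + `|d|) by rewrite divr_gt0// !ltr_pwDl.
have [s sE] := muA Y p _ k0; have [t tE] := nuA Y p _ k0.
exists ([seq (c * ca.1, ca.2) | ca <- s] ++ [seq (d * ca.1, ca.2) | ca <- t]) => b.
 rewrite big_cat !big_map /=.
under eq_bigr do rewrite -mulrA.
under [in X in _ - (_ + X)]eq_bigr do rewrite -mulrA.
rewrite -!mulr_sumr opprD addrACA -!mulrBr.
apply: le_trans (ler_normD _ _) _; rewrite !normrM.
apply: le_trans (lerD (ler_wpM2l (normr_ge0 c) (sE b)) (ler_wpM2l (normr_ge0 d) (tE b))) _.
rewrite -mulrDl mulrA ler_pdivrMr ?ltr_pwDl//.
rewrite mulrC; apply: ler_wpM2l; first exact: ltW.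
by rewrite -addrA lerDr.
Qed.

(** By elementarity the formula [theta_n] has a solution in [M], and the average along that single
    solution is uniformly close to [mu]. *)
Lemma fim_approximable (M : set U) (X : finType) (mu : formula L (X + U) -> R) :
  elementary_substructure M -> keisler_measure mu -> fim M mu -> approximable M mu.
Proof.
move=> elM muK muF Y p e e0.
have [m [c [p' [p'0 p'E]]]] := parameter_free p.
have [theta [thetaM thetaE _]] := muF (Y + 'I_m)%type p' p'0.
have [N NE] := thetaE e e0.
have [Mth cth] := thetaM (maxn N 1).
have [a aM ath] := elementary_witness elM Mth cth.
pose row i : point_of M X := exist (fun a => forall x, M (a x)) (fun j => a (i, j))
  (fun j => aM (i, j)).
exists [seq ((maxn N 1)%:R^-1, row i) | i <- enum 'I_(maxn N 1)] => b.
apply: ltW.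
have := NE _ a (leq_maxl _ _) ath (pairing b c).
rewrite (keisler_equiv muK (p := inst p' (pairing b c)) (q := inst p b)); last first.
  by move=> x; rewrite !holds_inst.
congr (`|_ - _| < _); rewrite /Av big_map mulr_sumr big_enum /=.
apply: eq_bigr => i _; congr (_ * _%:R); apply/congr1/asbool_equiv_eq.
by rewrite holds_inst.
Qed.

Section MorleyIntegral.
Variables (K : Type) (M : set U).
Hypotheses (natK : smaller [set: nat] K) (satU : saturated U K) (MK : smaller M K).
Variables (X : Type) (Y : finType).
Variables (mu : formula L (X + U) -> R) (nu : formula L (Y + U) -> R).
Hypotheses (muA : approximable M mu) (nuK : keisler_measure nu).

Let left_steps (p : formula L ((X + Y) + U)) (s : seq (R * point_of M X)) :=
  [seq (ca.1, inst_left p (sval ca.2)) | ca <- s].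

(** Approximability replaces the integrand by a combination of formulas [phi(a, y)] with [a] in [M].
    These are over [B], so they define step functions both on types and on tuples, and a regular
    extension integrates them to the same value as [nu]. *)
Lemma morley_integral (p : formula L ((X + Y) + U)) :
  is_integral nu (fun b => mu (inst p b)) (morley M mu nu p).
Proof.
pose B := M `|` params p; pose F : borel_ctype B Y -> R := Fmap mu p.
have BK : smaller B K by apply: smaller_setU_finite => //; apply: finite_params.
(* Every type over the small base [B] is realized, so the default value 0 of [Fmap] never occurs. *)
have FE q : exists2 b, realizes b q & F q = mu (inst p b).
  have [b bq] := satU BK q.
  have [|b' b'q FqE] := @xgetPex _ (0 : R)
      [set r | exists2 b : Y -> U, realizes b q & r = mu (inst p b)].
    by exists (mu (inst p b)), b.
  by exists b'.
pose st s (q : borel_ctype B Y) : R :=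
  \sum_(cp <- s) cp.1 * \1_(@ctype_clopen L U B Y cp.2) q.
have stP (P : probability (borel_ctype B Y) R) s : is_restriction nu P ->
    (forall cp, cp \in s -> formula_over B cp.2) ->
    P.-integrable setT (EFin \o st s) /\
    (\int[P]_q (st s q)%:E = (step_int nu s)%:E)%E.
  move=> Pnu; elim: s => [|[c r] s IH] sB.
    have -> : st [::] = cst 0 by apply/funext => q; rewrite /st big_nil.
    split; first exact: (finite_measure_integrable_cst P 0 (@measurableT _ _)).
    by rewrite /= integral0 /step_int big_nil.
  have [|si sI] := IH; first by move=> cp cps; apply: sB; rewrite inE cps orbT.
  have Br : formula_over B r by apply: (sB (c, r)); rewrite mem_head.
  have mr : measurable (@ctype_clopen L U B Y r : set (borel_ctype B Y)).
    by apply: sub_sigma_algebra; apply: open_clopen.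
  have ri := integrable_indic P mr.
  have cri := integrableZl measurableT c ri.
  have stE : EFin \o st ((c, r) :: s) = ((fun q =>
      c%:E * (\1_(@ctype_clopen L U B Y r) q)%:E) \+ (EFin \o st s))%E.
    by apply/funext => q; rewrite /= /st big_cons EFinD EFinM.
  split; first by rewrite stE; apply: integrableD.
  rewrite -[X in integral _ _ X]/(EFin \o st ((c, r) :: s)) stE integralD//.
  rewrite integralZl// integral_indic// setIT.
  rewrite /step_int big_cons EFinD EFinM; congr (_ * _ + _)%E; last exact: sI.
  exact: (restriction_clopen Pnu).
have approx e : 0 < e -> exists s : seq (R * formula L (Y + U)),
    [/\ forall cp, cp \in s -> formula_over B cp.2,
        forall q, `|F q - st s q| <= e &
        forall b, `|mu (inst p b) - step_val s b| <= e].
  move=> e0; have [s sE] := muA p e0.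
  exists (left_steps p s); have sB cp : cp \in left_steps p s -> formula_over B cp.2.
    elim: (s) => [//|ca t IH]; rewrite /= inE => /predU1P[->|//].
    exact: formula_over_inst_left (svalP ca.2).
  have sv b : step_val (left_steps p s) b =
      \sum_(ca <- s) ca.1 * indic_formula R p (pairing (sval ca.2) b).
    rewrite /step_val /left_steps big_map; apply: eq_bigr => ca _ /=; congr (_ * _%:R).
    by apply/congr1/asbool_equiv_eq; rewrite holds_inst_left.
  split=> // [q|b]; last by rewrite sv.
  have [b bq ->] := FE q.
  (* A formula over [B] belongs to [q] exactly when the realization [b] satisfies it. *)
  suff -> : st (left_steps p s) q = step_val (left_steps p s) b by rewrite sv.
  rewrite /st /step_val !big_seq; apply: eq_bigr => cp /sB Bcp; congr (_ * _).
  rewrite indicE; have [cpq|cpNq] := ctype_compl (svalP q) Bcp.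
    by rewrite mem_set// indic_formula1//; exact: bq cpq.
  have bNp : ~ holds b cp.2 by apply/holdsN; exact: bq cpNq.
  by rewrite indic_formula0// memNset// => /bq.
have FP (P : probability (borel_ctype B Y) R) : is_restriction nu P ->
    forall e, 0 < e -> exists g : borel_ctype B Y -> R,
    P.-integrable setT (EFin \o g) /\ forall x, `|F x - g x| <= e.
  move=> Pnu e /approx[s [sB sF _]]; exists (st s); split=> //.
  by have [] := stP P s Pnu sB.
have [P Pnu] := restriction_exists B nuK.
(* Some extension with a finite integral exists, so [morley] does not return its default. It may
   have picked another extension [P'], to which the same estimates apply. *)
have [|P' P'nu rE] := @xgetPex _ (0 : R)
    [set r | exists2 P : probability (borel_ctype B Y) R, is_restriction nu P &
             r%:E = (\int[P]_q (Fmap mu p q)%:E)%E].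
  have [s [sB sF _]] := approx 1 ltr01; have [si sI] := stP P s Pnu sB.
  have [r rE _] := uniform_limit_integral (FP P Pnu) ler01 si sF sI.
  by exists r, P.
move=> e e0; have [s [sB sF sv]] := approx e e0; have [si sI] := stP P' s P'nu sB.
exists s; split=> //.
have [r rE' rI] := uniform_limit_integral (FP P' P'nu) (ltW e0) si sF sI.
suff -> : morley M mu nu p = r by [].
by apply: EFin_inj; rewrite -rE' -rE.
Qed.

End MorleyIntegral.
End Morley.

(** * Random words *)

Section ExpectedWord.
Variables (R : realType) (r : R).
Hypothesis r01 : 0 <= r <= 1.

(* Words of independent Bernoulli(r) letters; the last letter is split off, as in
   the recursion for Morley powers. *)
Fixpoint expect (n : nat) (G : seq bool -> R) : R :=
  if n is n'.+1 then
    r * expect n' (fun s => G (rcons s true)) +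
    (1 - r) * expect n' (fun s => G (rcons s false))
  else G [::].

Lemma le_expect n G H : (forall s, size s = n -> G s <= H s) -> expect n G <= expect n H.
Proof.
have /andP[r0 r1] := r01.
elim: n G H => [|n IH] G H GH /=; first exact: GH.
by rewrite lerD// ler_wpM2l ?subr_ge0//; apply: IH => s sn; apply: GH;
  rewrite size_rcons sn.
Qed.

Lemma eq_expect n G H : (forall s, size s = n -> G s = H s) -> expect n G = expect n H.
Proof.
elim: n G H => [|n IH] G H GH /=; first exact: GH.
by congr (_ * _ + _ * _); apply: IH => s sn; apply: GH; rewrite size_rcons sn.
Qed.

Lemma expectD n G H : expect n (fun s => G s + H s) = expect n G + expect n H.
Proof. by elim: n G H => //= n IH G H; rewrite !IH; ring. Qed.

Lemma expectZ n c G : expect n (fun s => c * G s) = c * expect n G.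
Proof. by elim: n G => //= n IH G; rewrite !IH; ring. Qed.

Lemma expect_cst n c : expect n (fun=> c) = c.
Proof. by elim: n => //= n ->; ring. Qed.

Lemma expectB n G H : expect n (fun s => G s - H s) = expect n G - expect n H.
Proof.
rewrite -mulN1r -expectZ -expectD; apply: eq_expect => s _.
by rewrite mulN1r.
Qed.

Lemma expect_sum (I : Type) (t : seq I) n (G : I -> seq bool -> R) :
  expect n (fun s => \sum_(i <- t) G i s) = \sum_(i <- t) expect n (G i).
Proof.
elim: t => [|i t IH].
  by rewrite big_nil -[RHS](expect_cst n); apply: eq_expect => s _; rewrite big_nil.
by rewrite big_cons -IH -expectD; apply: eq_expect => s _; rewrite big_cons.
Qed.

Lemma norm_expect_le n G e : (forall s, size s = n -> `|G s| <= e) -> `|expect n G| <= e.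
Proof.
move=> Ge; rewrite ler_norml -[e in X in _ && X](expect_cst n) -[- e](expect_cst n).
by apply/andP; split; apply: le_expect => s /Ge; rewrite ler_norml => /andP[].
Qed.

End ExpectedWord.

(** * Morley products along words *)

Section MorleyWords.
Variables (R : realType) (L : language) (U : structure L) (K : Type) (M : set U).
Hypotheses (natK : smaller [set: nat] K) (satU : saturated U K) (MK : smaller M K).

Lemma keisler_rename_vars (X Y : Type) (h : X -> Y) (mu : formula L (Y + U) -> R) :
  keisler_measure mu -> keisler_measure (fun p => mu (rename_vars h p)).
Proof.
move=> muK; split=> [p||p q pq|p q npq].
- exact: (keisler_ge0 muK).
- by apply: (keisler_all muK) => a; apply/holds_rename_vars; exact: holdsT.
- by apply: (keisler_equiv muK) => a; rewrite !holds_rename_vars.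
- rewrite -(keisler_add muK) => [//|[a /holdsI[]]].
  rewrite !holds_rename_vars => ap aq; apply: npq.
  by exists (a \o h); apply/holdsI.
Qed.

(** Change of variables for the projection [b \o h] of tuples, under which [nu'] has image [nu]. *)
Lemma is_integral_rename (X Y : Type) (h : X -> Y) (nu : formula L (X + U) -> R)
    (nu' : formula L (Y + U) -> R) f I :
  (forall q, nu' (rename_vars h q) = nu q) -> is_integral nu f I ->
  is_integral nu' (fun b => f (b \o h)) I.
Proof.
move=> nu'E fI e e0; have [s [fs Is]] := fI e e0.
exists [seq (cp.1, rename_vars h cp.2) | cp <- s]; split=> [b|].
  rewrite /step_val big_map /=; apply: le_trans (fs (b \o h)).
  rewrite le_eqVlt; apply/orP; left; apply/eqP; congr `|_ - _|.
  apply: eq_bigr => cp _; congr (_ * _%:R); apply/congr1/asbool_equiv_eq.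
  exact: holds_rename_vars.
rewrite /step_int big_map /=; apply: le_trans Is.
by under eq_bigr do rewrite nu'E.
Qed.

(** Each axiom holds for the integrand at every [b]; it passes to the product by monotonicity,
    linearity and uniqueness of the integral. *)
Lemma morley_keisler (X : Type) (Y : finType) (mu : formula L (X + U) -> R)
    (nu : formula L (Y + U) -> R) : approximable M mu -> keisler_measure mu ->
  keisler_measure nu -> keisler_measure (morley M mu nu).
Proof.
move=> muA muK nuK; have mI := morley_integral natK satU MK muA nuK.
split=> [p||p q pq|p q npq].
- apply: (le_is_integral nuK (is_integral_cst 0 nuK) (mI p)) => b.
  exact: (keisler_ge0 muK).
- apply: (is_integral_unique nuK (mI _)).
  rewrite (_ : (fun b => _) = fun=> 1); first exact: is_integral_cst.
  apply/funext => b; apply: (keisler_all muK) => a.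
  by apply/holds_inst; exact: holdsT.
- apply: (is_integral_unique nuK (mI _)).
  rewrite (_ : (fun b => _) = fun b => mu (inst q b)); first exact: mI.
  apply/funext => b; apply: (keisler_equiv muK) => a.
  by rewrite !holds_inst.
- apply: (is_integral_unique nuK (mI _)).
  rewrite (_ : (fun b => _) = fun b => mu (inst p b) + mu (inst q b)).
    by apply: is_integralD; apply: mI.
  apply/funext => b; rewrite -(keisler_add muK) => [//|[a /holdsI[]]].
  rewrite !holds_inst => ap aq; apply: npq.
  by exists (pairing a b); apply/holdsI.
Qed.

Section Words.
Variable X : finType.
Implicit Types (m : nat -> formula L (X + U) -> R).

(** Varying the factor with its index treats mixed words and Morley powers alike; the factor of
    largest index stands on the left of the product. *)
Fixpoint word_power m (n : nat) : formula L (('I_n.+1 * X) + U) -> R :=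
  match n with
  | 0 => fun p => m 0%N (rename_vars snd p)
  | n'.+1 => fun p =>
      morley M (m n'.+1) (@word_power m n') (rename_vars (@split_last n'.+1 X) p)
  end.

Lemma morley_power_word mu n : morley_power M mu n = word_power (fun=> mu) (n := n).
Proof. by elim: n => //= n ->. Qed.

Lemma eq_word_power m m' n : (forall i, (i <= n)%N -> m i = m' i) ->
  word_power m (n := n) = word_power m' (n := n).
Proof.
elim: n => [|n IH] mm' /=; first by rewrite mm'.
by rewrite IH ?mm'// => i iln; apply: mm'; apply: leq_trans iln _.
Qed.

Lemma word_power_keisler m n : (forall i, approximable M (m i)) ->
  (forall i, keisler_measure (m i)) -> keisler_measure (word_power m (n := n)).
Proof.
move=> mA mK; elim: n => [|n IH] /=; apply: keisler_rename_vars => //.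
exact: morley_keisler.
Qed.

Lemma split_last_max n (x : X) : @split_last n X (ord_max, x) = inl x.
Proof. by rewrite /split_last /= unlift_none. Qed.

Lemma split_last_lift n (i : 'I_n) (x : X) :
  @split_last n X (lift ord_max i, x) = inr (i, x).
Proof. by rewrite /split_last /= liftK. Qed.

Definition reindex k n (e : 'I_k -> 'I_n) (z : 'I_k * X) : 'I_n * X := (e z.1, z.2).

Lemma below_last k n (e : 'I_k -> 'I_n.+2) : (forall i, (e i < n.+1)%N) ->
  exists e1 : 'I_k -> 'I_n.+1, forall i, e i = lift ord_max (e1 i).
Proof.
move=> en; exists (fun i => inord (e i)) => i; apply: val_inj.
by rewrite -[RHS]/(nat_of_ord (lift ord_max _)) lift_max inordK.
Qed.

(* Along an increasing selection of equal letters, a word marginalizes to the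
   power of that letter; no commutation of Morley products is involved. *)
Lemma word_power_marginal m mu n k (e : 'I_k.+1 -> 'I_n.+1)
    (p : formula L (('I_k.+1 * X) + U)) :
  (forall i, approximable M (m i)) -> (forall i, keisler_measure (m i)) ->
  (forall i, m (e i) = mu) -> (forall i j : 'I_k.+1, (i < j)%N -> (e i < e j)%N) ->
  word_power m (rename_vars (reindex e) p) = word_power (fun=> mu) p.
Proof.
move=> mA mK; have WK n' := word_power_keisler n' mA mK.
elim: n k e p => [|n IH] k e p me ltE.
  case: k => [|k] in e p me ltE *; last first.
    by have := ltE ord0 ord_max isT; rewrite [e ord_max]ord1.
  have <- : m 0%N = mu by rewrite -(me ord0) [e ord0]ord1.
  apply: (keisler_equiv (mK 0%N)) => a; rewrite !holds_rename_vars.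
  set a1 := (X in holds X _); set a2 := (X in _ <-> holds X _).
  by have -> : a1 = a2 by apply/funext => -[].
have muE : mu = m (e ord_max) by rewrite me.
have muA : approximable M mu by rewrite muE.
have muK : keisler_measure mu by rewrite muE.
have [e_last|e_last] := eqVneq (e ord_max) ord_max; last first.
  have [|e1 e1E] := @below_last _ _ e.
    move=> i; apply: leq_ltn_trans (_ : (e i <= e ord_max)%N) _.
      have := leq_ord i; rewrite leq_eqVlt => /predU1P[ik|/(ltE i ord_max)/ltnW//].
      by rewrite (_ : i = ord_max)//; apply: val_inj.
    by rewrite ltn_neqAle -ltnS ltn_ord andbT; apply: contra e_last => /eqP eE;
      apply/eqP; exact: val_inj.
  rewrite -(IH k e1) => [/=|i|i j /ltE]; last by rewrite !e1E !lift_max.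
    (* The last letter is not selected: its variable does not matter for the formula, so the
       integrand is the indicator of a formula in the earlier variables. *)
    apply: (is_integral_unique (WK n) (morley_integral natK satU MK (mA _) (WK n) _)).
    rewrite (_ : (fun b => _) = indic_formula R (rename_vars (reindex e1) p)).
      exact: is_integral_indic.
    apply/funext => b.
    have pE a : holds a (inst (rename_vars (@split_last n.+1 X)
        (rename_vars (reindex e) p)) b) <-> holds b (rename_vars (reindex e1) p).
      rewrite holds_inst !holds_rename_vars.
      set a1 := (X in holds X _); set a2 := (X in _ <-> holds X _).
      have -> // : a1 = a2.
      by apply/funext => -[i x]; rewrite /a1 /= /reindex /= e1E split_last_lift.
    have [bp|bNp] := pselect (holds b (rename_vars (reindex e1) p)).
      by rewrite indic_formula1//; apply: (keisler_all (mK _)) => a; apply/pE.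
    by rewrite indic_formula0//; apply: (keisler_none (mK _)) => -[a /pE].
  by rewrite -(me i) e1E lift_max.
have mn : m n.+1 = mu by rewrite muE e_last.
(* The last letter is selected. If it is the only one, the integrand is constant; otherwise both
   sides integrate the same function of the earlier selected variables. *)
case: k => [|k] in e p me ltE muE e_last *.
  rewrite /= mn.
  apply: (is_integral_unique (WK n) (morley_integral natK satU MK muA (WK n) _)).
  rewrite (_ : (fun b => _) = fun=> mu (rename_vars snd p)); first exact: is_integral_cst.
  apply/funext => b; apply: (keisler_equiv muK) => a.
  rewrite holds_inst !holds_rename_vars.
  set a1 := (X in holds X _); set a2 := (X in _ <-> holds X _).
  have -> // : a1 = a2.
  apply/funext => -[i x]; rewrite /a1 /= /reindex /=.
  by rewrite (_ : i = ord_max) ?e_last ?split_last_max// ord1 [ord_max]ord1.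
have [|e1 e1E] := @below_last _ _ (e \o lift ord_max).
  by move=> i; have := ltE (lift ord_max i) ord_max; rewrite e_last lift_max; apply.
have W'K := word_power_keisler k (fun=> muA) (fun=> muK).
rewrite /= mn.
apply: (is_integral_unique (WK n) (morley_integral natK satU MK muA (WK n) _)).
have := morley_integral natK satU MK muA W'K (rename_vars (@split_last k.+1 X) p).
(* The induction hypothesis says that the shorter word marginalizes along [e1] to the shorter power,
   so the integral can be transported. *)
move=> /(is_integral_rename (h := reindex e1) (nu' := word_power m (n := n))).
rewrite (_ : (fun b => _) = fun b => mu (inst
    (rename_vars (@split_last n.+1 X) (rename_vars (reindex e) p)) b)).
  apply=> q; apply: IH => [i|i j ij].
    by rewrite -(me (lift ord_max i)) -[e _]/((e \o lift ord_max) i) e1E lift_max.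
  have := ltE (lift ord_max i) (lift ord_max j).
  by rewrite -[e (lift ord_max i)]/((e \o lift ord_max) i)
    -[e (lift ord_max j)]/((e \o lift ord_max) j) !e1E !lift_max; apply.
apply/funext => b; apply: (keisler_equiv muK) => a.
rewrite !holds_inst !holds_rename_vars.
set a1 := (X in holds X _); set a2 := (X in _ <-> holds X _).
have -> // : a1 = a2.
apply/funext => -[i x]; rewrite /a1 /a2 /= /reindex /=.
case: (unliftP ord_max i) => [j ->|->]; last by rewrite e_last !split_last_max.
by rewrite split_last_lift -[e _]/((e \o lift ord_max) j) e1E split_last_lift.
Qed.

Section Mixture.
Variables (mu nu : formula L (X + U) -> R) (r : R).
Hypotheses (r01 : 0 <= r <= 1).
Hypotheses (muA : approximable M mu) (nuA : approximable M nu).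
Hypotheses (muK : keisler_measure mu) (nuK : keisler_measure nu).

(** The letter [true] stands for [mu] and [false] for [nu]; past the end of the word the default is
    [nu]. *)
Definition letters (s : seq bool) (i : nat) := if nth false s i then mu else nu.

Lemma letters_approximable s i : approximable M (letters s i).
Proof. by rewrite /letters; case: ifP. Qed.

Lemma letters_keisler s i : keisler_measure (letters s i).
Proof. by rewrite /letters; case: ifP. Qed.

Definition mixture : formula L (X + U) -> R := fun p => r * mu p + (1 - r) * nu p.

Lemma mixture_keisler : keisler_measure mixture.
Proof.
have /andP[r0 r1] := r01; split=> [p||p q pq|p q npq].
- by rewrite addr_ge0// mulr_ge0 ?subr_ge0// (keisler_ge0 muK, keisler_ge0 nuK).
- by rewrite /mixture (keisler_true muK) (keisler_true nuK); ring.
- by rewrite /mixture (keisler_equiv muK pq) (keisler_equiv nuK pq).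
- by rewrite /mixture (keisler_add muK npq) (keisler_add nuK npq); ring.
Qed.

(** Uniform closeness to [f] does not involve the measure, so the step function found for the empty
    word serves all words at once. *)
Lemma is_integral_expect (Y : Type) n (W : seq bool -> formula L (Y + U) -> R) f
    (I : seq bool -> R) :
  (forall s, keisler_measure (W s)) -> (forall s, is_integral (W s) f (I s)) ->
  is_integral (fun p => expect r n (fun s => W s p)) f (expect r n I).
Proof.
move=> WK fI e e0; have [t [ft _]] := fI [::] e e0; exists t; split=> //.
have -> : step_int (fun p => expect r n (fun s => W s p)) t =
    expect r n (fun s => step_int (W s) t).
  by rewrite /step_int expect_sum; apply: eq_bigr => cp _; rewrite expectZ.
rewrite -expectB; apply: norm_expect_le => // s _.
exact: (is_integral_step (WK s) (fI s)).
Qed.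

(** The Morley product is expanded linearly in both factors: the left one is split into [mu] and
    [nu], the right one is an expectation by induction. The left factor becomes the last letter of a
    word. *)
Lemma mixture_power n p : morley_power M mixture n p =
  expect r n.+1 (fun s => word_power (letters s) (n := n) p).
Proof.
have mixA : approximable M mixture by exact: approximable_comb.
have mixK := mixture_keisler.
have WK s n' := word_power_keisler n' (letters_approximable s) (letters_keisler s).
rewrite morley_power_word; elim: n p => [|n IH] p; first by [].
have PK : keisler_measure (word_power (fun=> mixture) (n := n)) by exact: word_power_keisler.
rewrite [LHS]/=; set p' := rename_vars _ p.
(* The contribution of the words whose new last letter is [mu']. *)
pose J mu' := expect r n.+1 (fun s => morley M mu' (word_power (letters s) (n := n)) p').
have JI mu' : approximable M mu' ->
    is_integral (word_power (fun=> mixture) (n := n)) (fun b => mu' (inst p' b)) (J mu').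
  move=> mu'A; rewrite (_ : word_power _ (n := n) =
    fun p => expect r n.+1 (fun s => word_power (letters s) (n := n) p)); last exact/funext.
  apply: is_integral_expect => s; first exact: WK.
  exact: (morley_integral natK satU MK mu'A (WK s n) p').
have -> : morley M mixture (word_power (fun=> mixture) (n := n)) p' =
    r * J mu + (1 - r) * J nu.
  apply: (is_integral_unique PK (morley_integral natK satU MK mixA PK _)).
  by apply: is_integralD; apply: is_integralZ; apply: JI.
have lastE c s : size s = n.+1 -> word_power (letters (rcons s c)) (n := n.+1) p =
    morley M (if c then mu else nu) (word_power (letters s) (n := n)) p'.
  move=> sn; rewrite /= {1}/letters nth_rcons sn ltnn eqxx; congr (morley _ _ _ _).
  by apply: eq_word_power => i iln; rewrite /letters nth_rcons sn ltnS iln.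
have JE c : J (if c then mu else nu) =
    expect r n.+1 (fun s => word_power (letters (rcons s c)) (n := n.+1) p).
  by apply: eq_expect => s sn; apply/esym; exact: lastE.
by rewrite (JE true) (JE false).
Qed.

End Mixture.
End Words.
End MorleyWords.

(** * Chebyshev's inequality for Bernoulli words *)

Section LargeNumbers.
Variables (R : realType) (r : R).
Hypothesis r01 : 0 <= r <= 1.

Definition deviation (s : seq bool) : R :=
  (count (pred1 true) s)%:R - (size s)%:R * r.

Lemma deviation_rcons s b : deviation (rcons s b) = deviation s + (b%:R - r).
Proof.
rewrite /deviation size_rcons -cats1 count_cat /= addn0 eqb_id natrD -[(size s).+1]addn1 natrD.
move: (b%:R : R) (count _ s)%:R (size s)%:R => x y z; ring.
Qed.

(** The variance of a binomial variable. In the recursion the cross terms have weights [r * (1 - r)]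
    and [(1 - r) * (- r)], which cancel. *)
Lemma expect_deviation2 n : expect r n (fun s => deviation s ^+ 2) = n%:R * (r * (1 - r)).
Proof.
elim: n => [|n IH]; first by rewrite /= /deviation /= !mul0r subrr expr0n.
have step (b : bool) c : b%:R = c -> expect r n (fun s => deviation (rcons s b) ^+ 2) =
    n%:R * (r * (1 - r)) + (2 * (c - r)) * expect r n deviation + (c - r) ^+ 2.
  move=> bc; rewrite -IH -expectZ -[X in _ + X](expect_cst r n) -!expectD.
  by apply: eq_expect => s _; rewrite deviation_rcons bc; ring.
by rewrite /= (step true 1)// (step false 0)// -[n.+1]addn1 natrD; ring.
Qed.

(* The threshold [n ^ (3/2)] for the squared deviation lies strictly between
   the variance, of order [n], and [n ^ 2]. *)
Definition typical (s : seq bool) : bool :=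
  deviation s ^+ 2 <= (size s)%:R * Num.sqrt (size s)%:R.

(** Chebyshev: the indicator of typical words is at least [1 - c * deviation s ^+ 2], whose
    expectation is [1 - r * (1 - r) / sqrt n]. *)
Lemma expect_typical n : (0 < n)%N ->
  1 - (Num.sqrt n%:R)^-1 <= expect r n (fun s => (typical s)%:R).
Proof.
move=> n0; have /andP[r0 r1] := r01.
have nR : 0 < n%:R :> R by rewrite ltr0n.
have w0 : 0 < Num.sqrt n%:R :> R by rewrite sqrtr_gt0.
set c := (n%:R * Num.sqrt n%:R : R)^-1.
have c0 : 0 < c by rewrite invr_gt0 mulr_gt0.
apply: (@le_trans _ _ (expect r n (fun s => 1 + (- c) * deviation s ^+ 2))).
  rewrite expectD expect_cst expectZ expect_deviation2 lerD2l mulNr lerN2.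
  rewrite /c invfM mulrACA mulVf ?gt_eqF// mul1r ger_pMr ?invr_gt0//.
  by rewrite mulr_ile1// ?subr_ge0// gerBl.
apply: le_expect => // s sn; rewrite mulNr; have [_|] := boolP (typical s).
  by rewrite lerBlDr lerDl mulr_ge0 ?sqr_ge0 ?ltW.
rewrite /typical sn -ltNge => h; rewrite subr_le0.
have -> : 1 = c * (n%:R * Num.sqrt n%:R) by rewrite mulVf// gt_eqF// mulr_gt0.
by rewrite ler_pM2l// ltW.
Qed.

(** With [w] the square root of the length, [w ^+ 3] is at most [d ^+ 2 * w ^+ 4] once [w] reaches
    [d ^- 2]. *)
Lemma typical_deviation (d : R) : 0 < d -> exists n0, forall s,
  (n0 <= size s)%N -> typical s -> `|deviation s| <= d * (size s)%:R.
Proof.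
move=> d0; pose x := (d ^+ 2)^-1.
have x0 : 0 < x by rewrite invr_gt0 exprn_gt0.
exists (Num.truncn (x ^+ 2)).+1 => s n0s; rewrite /typical => ts.
have xn : x ^+ 2 <= (size s)%:R.
  by apply: ltW; apply: lt_le_trans (truncnS_gt _) _; rewrite ler_nat.
set w := Num.sqrt (size s)%:R in ts.
have w2 : (size s)%:R = w ^+ 2 by rewrite sqr_sqrtr.
have xw : x <= w.
  have <- : Num.sqrt (x ^+ 2) = x by rewrite sqrtr_sqr ger0_norm// ltW.
  exact: ler_wsqrtr.
have dw : 1 <= d ^+ 2 * w.
  have -> : 1 = d ^+ 2 * x by rewrite mulfV// gt_eqF// exprn_gt0.
  by rewrite ler_pM2l// exprn_gt0.
have w0 : 0 <= w by rewrite sqrtr_ge0.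
rewrite -(ler_pXn2r (n := 2))// ?nnegrE//; last by rewrite mulr_ge0// ltW.
rewrite real_normK ?num_real//; apply: le_trans ts _.
rewrite -/w w2 exprMn -exprM (_ : w ^+ 2 * w = w ^+ 3 * 1); last by ring.
rewrite (_ : d ^+ 2 * _ = w ^+ 3 * (d ^+ 2 * w)); last by ring.
by rewrite ler_wpM2l// exprn_ge0.
Qed.

Lemma typical_counts (N : nat) (e : R) : 0 < r < 1 -> 0 < e -> exists n0, forall s,
  (n0 <= size s)%N -> typical s ->
  [/\ (N <= count (pred1 true) s)%N, (N <= count (pred1 false) s)%N &
      `|r - (count (pred1 true) s)%:R / (size s)%:R| <= e].
Proof.
move=> /andP[r0 r1] e0.
(* Deviation at most [d] times the length [m] leaves at least [r * m / 2] letters [true] and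
   [(1 - r) * m / 2] letters [false]; both are at least [d * m], hence at least [N] for long
   words. *)
pose d := Num.min e (Num.min (r / 2) ((1 - r) / 2)).
have d0 : 0 < d by rewrite !lt_min e0 !divr_gt0// subr_gt0.
have [dle dlr dl1] : [/\ d <= e, d <= r / 2 & d <= (1 - r) / 2].
  by rewrite /d; split; rewrite !ge_min lexx ?orbT.
have [n0 n0P] := typical_deviation d0.
exists (maxn n0 (Num.truncn (N%:R / d)).+1) => s; rewrite geq_max => /andP[n0s ns] ts.
have := n0P s n0s ts; rewrite /deviation.
have sE : (size s)%:R = (count (pred1 true) s)%:R + (count (pred1 false) s)%:R :> R.
  rewrite -natrD -(count_predC (pred1 true) s); congr (_ + _)%:R.
  by apply: eq_count => -[].
have Ns : N%:R <= d * (size s)%:R.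
  rewrite mulrC -ler_pdivrMr//; apply: ltW.
  by apply: lt_le_trans (truncnS_gt _) _; rewrite ler_nat.
have s0 : 0 < (size s)%:R :> R by rewrite ltr0n (leq_trans _ ns).
have ds1 : d * (size s)%:R <= r / 2 * (size s)%:R by rewrite ler_wpM2r// ltW.
have ds2 : d * (size s)%:R <= (1 - r) / 2 * (size s)%:R by rewrite ler_wpM2r// ltW.
have ds3 : d * (size s)%:R <= e * (size s)%:R by rewrite ler_wpM2r// ltW.
set k := (count (pred1 true) s)%:R in sE *; set l := (count (pred1 false) s)%:R in sE *.
set m := (size s)%:R in sE Ns s0 ds1 ds2 ds3 *.
move=> dev; split.
- rewrite -(ler_nat R) -/k; move: dev; rewrite ler_norml => /andP[? ?]; nra.
- rewrite -(ler_nat R) -/l; move: dev; rewrite ler_norml => /andP[? ?]; nra.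
- rewrite -(ler_pM2r s0) -[X in _ * X <= _](ger0_norm (ltW s0)) -normrM mulrBl.
  by rewrite divfK ?gt_eqF// distrC [r * m]mulrC (le_trans dev).
Qed.

End LargeNumbers.

(** * Positions of a letter, and averages split along them *)

Section Selection.
Implicit Types (s : seq bool) (c : bool).

Definition positions c s := [seq i <- iota 0 (size s) | nth false s i == c].

Lemma size_positions c s : size (positions c s) = count (pred1 c) s.
Proof.
rewrite size_filter -[in RHS](mkseq_nth false s) count_map.
by apply: eq_count.
Qed.

Lemma positions_sorted c s : sorted ltn (positions c s).
Proof. by apply: sorted_filter; [exact: ltn_trans|exact: iota_ltn_sorted]. Qed.

Lemma mem_positions c s i : i \in positions c s -> (i < size s)%N /\ nth false s i = c.
Proof. by rewrite mem_filter mem_iota => /andP[/eqP]. Qed.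

Definition embed k n (t : seq nat) (i : 'I_k) : 'I_n.+1 := inord (nth 0%N t i).

Lemma big_positions (R : realType) (f : nat -> R) s :
  \sum_(i < size s) f i =
  \sum_(i <- positions true s) f i + \sum_(i <- positions false s) f i.
Proof.
rewrite -(big_mkord xpredT) /index_iota subn0 (bigID (fun i => nth false s i == true)) /=.
by rewrite !big_filter; congr (_ + _); apply: eq_bigl => i; case: nth.
Qed.

End Selection.

Section AverageSplit.
Variables (R : realType) (L : language) (U : structure L) (X : finType).

Lemma sum_positions_Av c n s (a : 'I_n.+1 * X -> U) (p : formula L (X + U)) :
  \sum_(i <- positions c s) indic_formula R p (fun x => a (inord i, x)) =
  (size (positions c s))%:R *
    Av R (a \o reindex (embed (k := size (positions c s)) n (positions c s))) p.
Proof.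
rewrite /Av (big_nth 0%N) big_mkord.
have [->|k0] := eqVneq (size (positions c s)) 0%N; first by rewrite big_ord0 !mul0r.
by rewrite mulrA mulfV ?pnatr_eq0// mul1r; apply: eq_bigr.
Qed.

(** The weights are the letter frequencies. If a letter is absent, its weight is 0 and its empty
    average is 0 by convention. *)
Lemma Av_split n s (a : 'I_n.+1 * X -> U) (p : formula L (X + U)) : size s = n.+1 ->
  let k := (size (positions true s))%:R / n.+1%:R in
  Av R a p = k * Av R (a \o reindex (embed (k := size (positions true s)) n (positions true s))) p +
    (1 - k) * Av R (a \o reindex (embed (k := size (positions false s)) n (positions false s))) p.
Proof.
move=> sn k.
have n0 : n.+1%:R != 0 :> R by rewrite pnatr_eq0.
have -> : 1 - k = (size (positions false s))%:R / n.+1%:R.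
  apply: (mulIf n0); rewrite /k mulrBl mul1r !divfK// !size_positions.
  rewrite -[in X in X - _]sn -(count_predC (pred1 true) s) natrD addrC addKr.
  by congr _%:R; apply: eq_count => -[].
rewrite /k ![_ / _ * _]mulrAC -!sum_positions_Av -mulrDl -big_positions sn mulrC.
congr (_ * _); apply: eq_bigr => i _.
by rewrite inord_val.
Qed.

Lemma Av_ge0_le1 n (a : 'I_n * X -> U) (p : formula L (X + U)) : 0 <= Av R a p <= 1.
Proof.
have [n0|n0] := eqVneq n 0%N.
  by rewrite /Av [n%:R](_ : _ = 0) ?n0// invr0 mul0r lexx ler01.
rewrite /Av mulr_ge0 ?invr_ge0 ?ler0n ?sumr_ge0//=.
rewrite mulrC ler_pdivrMr ?ltr0n ?lt0n// mul1r -[X in _ <= X%:R](card_ord n) -sumr_const.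
by apply: ler_sum => i _; case: asboolP.
Qed.

End AverageSplit.

(** * Convex combinations of fim measures *)

Section MixtureFim.
Variables (R : realType) (L : language) (U : structure L) (K : Type) (M : set U).
Hypotheses (natK : smaller [set: nat] K) (satU : saturated U K) (MK : smaller M K).
Variables (X : finType) (mu nu : formula L (X + U) -> R) (r : R).
Hypotheses (muA : approximable M mu) (nuA : approximable M nu).
Hypotheses (muK : keisler_measure mu) (nuK : keisler_measure nu).
Hypothesis (r01 : 0 < r < 1).
Variables (thmu thnu : forall n, formula L (('I_n * X) + U)).
Hypotheses (thmuM : forall n, formula_over M (thmu n)).
Hypotheses (thnuM : forall n, formula_over M (thnu n)).
Hypothesis thmu1 : morley_power M mu n (thmu n.+1) @[n --> \oo] --> (1 : R).
Hypothesis thnu1 : morley_power M nu n (thnu n.+1) @[n --> \oo] --> (1 : R).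

Let r01W : 0 <= r <= 1.
Proof. by case/andP: r01 => r0 r1; rewrite !ltW. Qed.

(** The formula of [th] with as many variables as [s] has letters [c], placed at the positions of
    these letters. *)
Definition part n c s (th : forall n, formula L (('I_n * X) + U)) :
    formula L (('I_n.+1 * X) + U) :=
  rename_vars (reindex (embed (k := size (positions c s)) n (positions c s))) (th _).

Definition word_formula n s := FAnd (part n true s thmu) (part n false s thnu).

Definition typical_words n : seq (seq bool) :=
  [seq s <- [seq val t | t <- enum {: n.-tuple bool}] | typical r s].

Definition typical_formula n : formula L (('I_n.+1 * X) + U) :=
  foldr (fun s => FOr (word_formula n s)) FFalse (typical_words n.+1).

(* [typical_formula n] is consistent only for large [n]. *)
Definition mixture_formula n : formula L (('I_n * X) + U) :=
  match n with
  | 0 => FTrue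
  | n.+1 => if pselect (consistent (typical_formula n)) then typical_formula n else FTrue
  end.

Lemma mem_typical_words n s : (s \in typical_words n) = (size s == n) && typical r s.
Proof.
rewrite mem_filter andbC; congr (_ && _); apply/mapP/eqP => [[t _ ->]|sn].
  exact: size_tuple.
by exists (Tuple (introT eqP sn)); rewrite ?mem_enum.
Qed.

Lemma holds_typical_formula n a : holds a (typical_formula n) <->
  exists s, [/\ size s = n.+1, typical r s & holds a (word_formula n s)].
Proof.
rewrite /typical_formula; split.
  have : all (fun s => (size s == n.+1) && typical r s) (typical_words n.+1).
    by apply/allP => s; rewrite mem_typical_words.
  elim: (typical_words n.+1) => [_ []|s t IH /= /andP[/andP[/eqP sn ts] allt]].
  by move=> /holdsU[as_|]; [exists s|exact: IH].
move=> [s [/eqP sn ts as_]].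
have : s \in typical_words n.+1 by rewrite mem_typical_words sn.
elim: (typical_words n.+1) => [//|s' t IH]; rewrite inE => /predU1P[<-|st] /=.
  by apply/holdsU; left.
by apply/holdsU; right; apply: IH.
Qed.

Lemma mixture_formulaS n :
  (consistent (typical_formula n) /\ mixture_formula n.+1 = typical_formula n) \/
  (~ consistent (typical_formula n) /\ mixture_formula n.+1 = FTrue).
Proof. by rewrite /mixture_formula; case: pselect => h; [left|right]. Qed.

Lemma mixture_formula_over n : formula_over M (mixture_formula n).
Proof.
case: n => [|n]; first exact: formula_overT.
have [[_ ->]|[_ ->]] := mixture_formulaS n; last exact: formula_overT.
rewrite /typical_formula; elim: typical_words => [u []|s t IH] /=.
apply: formula_overU => //; apply: formula_overI; exact: formula_over_rename_vars.
Qed.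

Lemma mixture_formula_consistent n : consistent (mixture_formula n).
Proof.
have [u] := dom_inhabited U.
case: n => [|n]; first by exists (fun=> u); exact: holdsT.
have [[cons ->]|[_ ->]] := mixture_formulaS n; first exact: cons.
by exists (fun=> u); exact: holdsT.
Qed.

Local Notation word_measure s n := (@word_power R L U M X (letters mu nu s) n).

Let word_measure_keisler s n : keisler_measure (word_measure s n).
Proof.
apply: (word_power_keisler natK satU MK) => i.
  exact: letters_approximable.
exact: letters_keisler.
Qed.

(** The positions of [c] form an increasing selection of equal letters, so the marginal is a Morley
    power. Index [k] stands for [k.+1] variables. *)
Lemma word_measure_part n c s th k : size s = n.+1 -> size (positions c s) = k.+1 ->
  word_measure s n (part n c s th) = morley_power M (if c then mu else nu) k (th k.+1).
Proof.
move=> sn sk; rewrite /part sk morley_power_word.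
have inordE (i : 'I_k.+1) : nat_of_ord (embed n (positions c s) i) =
    nth 0%N (positions c s) i.
  rewrite inordK// -sn; apply: (mem_positions (c := c) _).1.
  by apply: mem_nth; rewrite sk.
apply: (word_power_marginal natK satU MK) => [i|i|i|i j ij].
- exact: letters_approximable.
- exact: letters_keisler.
- rewrite /letters inordE; have [|_ ->] := @mem_positions c s (nth 0%N (positions c s) i).
    by apply: mem_nth; rewrite sk.
  by [].
- rewrite !inordE.
  by apply: (sorted_ltn_nth ltn_trans 0%N (positions_sorted c s)); rewrite ?inE ?sk.
Qed.

(** In a long typical word both letters are frequent, so each part has measure at least [1 - d / 2];
    Bonferroni gives the conjunction. *)
Lemma word_formula_measure (d : R) : 0 < d -> exists n0, forall n s, (n0 <= n)%N ->
  size s = n.+1 -> typical r s -> 1 - d <= word_measure s n (word_formula n s).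
Proof.
move=> d0; have d20 : 0 < d / 2 by rewrite divr_gt0.
have /cvgrPdist_le/(_ _ d20)[Nmu _ Hmu] := thmu1.
have /cvgrPdist_le/(_ _ d20)[Nnu _ Hnu] := thnu1.
(* The successor compensates for [morley_power] at [k] having [k.+1] variables. Only the counts
   matter here, so the frequency tolerance is 1. *)
have [n0 n0P] := typical_counts (maxn Nmu Nnu).+1 r01 ltr01.
exists n0 => n s n0n sn ts.
have [|kt kf _] := n0P s _ ts; first by rewrite sn leqW.
rewrite -!size_positions in kt kf.
case kE : (size (positions true s)) kt => [//|k]; rewrite ltnS geq_max => /andP[kmu _].
case lE : (size (positions false s)) kf => [//|l]; rewrite ltnS geq_max => /andP[_ lnu].
apply: le_trans (keisler_FAnd_ge (word_measure_keisler s n) _ _).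
rewrite (word_measure_part _ sn kE) (word_measure_part _ sn lE).
have := Hmu _ kmu; have := Hnu _ lnu; rewrite /= !ler_norml => /andP[_ ?] /andP[_ ?].
lra.
Qed.

Lemma typical_formula_measure n s : size s = n.+1 -> typical r s ->
  word_measure s n (word_formula n s) <= word_measure s n (typical_formula n).
Proof.
move=> sn ts; apply: (keisler_le (word_measure_keisler s n)) => a as_.
by apply/holds_typical_formula; exists s.
Qed.

(** If the disjunction were inconsistent, no word of length [n.+1] could be typical, since its
    disjunct would have measure at least 1/2. But typical words have weight at least
    [1 - 1 / sqrt (n + 1)], positive for [n >= 1]. *)
Lemma typical_formula_consistent : exists n0, forall n, (n0 <= n)%N ->
  consistent (typical_formula n).
Proof.
have [n0 n0P] := word_formula_measure (d := 1 / 2) (divr_gt0 ltr01 (ltr0Sn _ 1)).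
exists (maxn n0 1) => n; rewrite geq_max => /andP[n0n n1].
apply: contrapT => incons.
have notyp s : size s = n.+1 -> ~~ typical r s.
  move=> sn; apply/negP => ts; have := n0P n s n0n sn ts.
  have := typical_formula_measure sn ts.
  rewrite (keisler_none (word_measure_keisler s n) incons); lra.
have := expect_typical r01W (ltn0Sn n).
rewrite (@eq_expect R r n.+1 _ (fun=> 0)) => [|s /notyp /negbTE -> //].
rewrite expect_cst subr_le0 leNgt invf_lt1 ?sqrtr_gt0 ?ltr0n//.
by rewrite -[X in X < _]sqrtr1 ltr_sqrt ?ltr1n ?ltr0n// ltnS n1.
Qed.

Lemma mixture_formula_measure :
  morley_power M (mixture mu nu r) n (mixture_formula n.+1) @[n --> \oo] --> (1 : R).
Proof.
apply/cvgrPdist_le => e e0; have e20 : 0 < e / 2 by rewrite divr_gt0.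
have [n0 n0P] := word_formula_measure e20.
pose x := (e / 2)^-1; have x0 : 0 < x by rewrite invr_gt0.
exists (maxn n0 (Num.truncn (x ^+ 2)).+1) => // n /=; rewrite geq_max => /andP[n0n xn].
rewrite (mixture_power natK satU MK) => //.
have xw : (Num.sqrt n.+1%:R)^-1 <= e / 2.
  rewrite -[e / 2]invrK -/x lef_pV2 ?posrE ?sqrtr_gt0 ?ltr0n//.
  have <- : Num.sqrt (x ^+ 2) = x by rewrite sqrtr_sqr ger0_norm// ltW.
  apply: ler_wsqrtr.
  by apply: ltW; apply: lt_le_trans (truncnS_gt _) _; rewrite ler_nat leqW.
have WT s : typical r s -> size s = n.+1 ->
    1 - e / 2 <= word_measure s n (mixture_formula n.+1).
  move=> ts sn; have [[_ ->]|[_ ->]] := mixture_formulaS n.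
    exact: le_trans (n0P n s n0n sn ts) (typical_formula_measure sn ts).
  by rewrite (keisler_true (word_measure_keisler s n)) gerBl ltW.
set I := expect _ _ _.
have I1 : I <= 1.
  rewrite -(expect_cst r n.+1 1); apply: le_expect => // s _.
  exact: (keisler_le1 (word_measure_keisler s n)).
(* Subtracting [e / 2] on atypical words as well is harmless: the bound is negative there. *)
have lower : expect r n.+1 (fun s => (typical r s)%:R) - e / 2 <= I.
  rewrite -[e / 2](expect_cst r n.+1) -expectB; apply: le_expect => // s sn.
  have [/WT/(_ sn)//|_] := boolP (typical r s).
  by rewrite sub0r (le_trans _ (keisler_ge0 (word_measure_keisler s n) _))// oppr_le0 ltW.
have := expect_typical r01W (ltn0Sn n).
rewrite ger0_norm ?subr_ge0//; lra.
Qed.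

Lemma mixture_formula_approx (Y : Type) (phi : formula L ((X + Y) + U)) :
  (forall eps : R, 0 < eps -> exists N : nat,
    forall n (a : 'I_n * X -> U), (N <= n)%N -> holds a (thmu n) ->
    forall b : Y -> U, `|mu (inst phi b) - Av R a (inst phi b)| < eps) ->
  (forall eps : R, 0 < eps -> exists N : nat,
    forall n (a : 'I_n * X -> U), (N <= n)%N -> holds a (thnu n) ->
    forall b : Y -> U, `|nu (inst phi b) - Av R a (inst phi b)| < eps) ->
  forall eps : R, 0 < eps -> exists N : nat,
    forall n (a : 'I_n * X -> U), (N <= n)%N -> holds a (mixture_formula n) ->
    forall b : Y -> U, `|mixture mu nu r (inst phi b) - Av R a (inst phi b)| < eps.
Proof.
move=> Hmu Hnu e e0; have e30 : 0 < e / 3 by rewrite divr_gt0.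
have [Nmu NmuP] := Hmu _ e30; have [Nnu NnuP] := Hnu _ e30.
have [n0 n0P] := typical_counts (maxn Nmu Nnu) r01 e30.
have [n1 n1P] := typical_formula_consistent.
exists (maxn n0 n1).+1 => -[//|n] a; rewrite ltnS geq_max => /andP[n0n n1n].
(* Beyond [n1] the fallback [FTrue], which says nothing about averages, cannot occur. *)
have [[_ ->]|[[]]] := mixture_formulaS n; last exact: n1P.
move=> /holds_typical_formula[s [sn ts as_]] b.
have [|kt kf kr] := n0P s _ ts; first by rewrite sn leqW.
rewrite -!size_positions !geq_max sn in kt kf kr.
case/andP: kt => kmu _; case/andP: kf => _ lnu.
move: as_ => /holdsI[/holds_rename_vars amu /holds_rename_vars anu].
rewrite (Av_split _ _ _ sn) /mixture.
have := NmuP _ _ kmu amu b; have := NnuP _ _ lnu anu b.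
set k := _ / _ in kr *.
set A2 := Av _ _ _; set A1 := Av _ _ _ => A2P A1P.
have /andP[A10 A11] : 0 <= A1 <= 1 by exact: Av_ge0_le1.
have /andP[A20 A21] : 0 <= A2 <= 1 by exact: Av_ge0_le1.
(* The error splits into those of the two averages, weighted by [r] and [1 - r], and that of the
   frequency [k] against [r]. The first two together and the third are each at most [e / 3]. *)
have -> : r * mu (inst phi b) + (1 - r) * nu (inst phi b) - (k * A1 + (1 - k) * A2) =
    r * (mu (inst phi b) - A1) + (1 - r) * (nu (inst phi b) - A2) + (r - k) * (A1 - A2).
  by ring.
apply: le_lt_trans (ler_normD _ _) _; rewrite normrM.
have h1 : `|r * (mu (inst phi b) - A1) + (1 - r) * (nu (inst phi b) - A2)| <= e / 3.
  have /andP[r0] := r01; rewrite -subr_gt0 => r1.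
  apply: le_trans (ler_normD _ _) _; rewrite !normrM (gtr0_norm r0) (gtr0_norm r1).
  have -> : e / 3 = r * (e / 3) + (1 - r) * (e / 3) by ring.
  by rewrite lerD// ler_pM2l// ltW.
have h2 : `|r - k| * `|A1 - A2| <= e / 3.
  rewrite -[e / 3]mulr1; apply: ler_pM => //.
  by rewrite ler_norml; apply/andP; split; lra.
lra.
Qed.

End MixtureFim.

Theorem theorem6p2 (R : realType) (L : language) (T : set (sentence L))
    (U : structure L) (K : Type) (M : set U) (X : finType)
    (mu nu : formula L (X + U) -> R) (r : R) :
  complete_theory T -> models U T -> monster U K ->
  elementary_substructure M -> smaller M K ->
  keisler_measure mu -> keisler_measure nu ->
  fim M mu -> fim M nu ->
  0 <= r <= 1 ->
  let lambda := fun p => r * mu p + (1 - r) * nu p in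
  keisler_measure lambda /\ fim M lambda.
Proof.
move=> _ _ [[natK _ _] satU _] elM MK muK nuK muF nuF r01 lambda.
split; first exact: mixture_keisler.
have muA := fim_approximable elM muK muF; have nuA := fim_approximable elM nuK nuF.
(* At the endpoints one letter has probability 0 and its count need not grow with the length, but
   [lambda] is then [nu] or [mu] itself. *)
have [r0|r0] := eqVneq r 0.
  rewrite (_ : lambda = nu)//; apply/funext => p.
  by rewrite /lambda r0 mul0r add0r subr0 mul1r.
have [r1|r1] := eqVneq r 1.
  rewrite (_ : lambda = mu)//; apply/funext => p.
  by rewrite /lambda r1 mul1r subrr mul0r addr0.
have r01' : 0 < r < 1 by case/andP: r01 => ? ?; rewrite !lt_neqAle eq_sym r0 r1; apply/andP.
move=> Y phi phi0.
have [thmu [thmuM thmuE thmu1]] := muF Y phi phi0.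
have [thnu [thnuM thnuE thnu1]] := nuF Y phi phi0.
exists (mixture_formula r thmu thnu); split=> [n||].
- split; last exact: mixture_formula_consistent.
  by apply: mixture_formula_over => k; [have [] := thmuM k|have [] := thnuM k].
- exact: (mixture_formula_approx natK satU MK muA nuA muK nuK r01' thmu1 thnu1).
- exact: (mixture_formula_measure natK satU MK muA nuA muK nuK r01' thmu1 thnu1).
Qed.
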